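(* Let $(\Gamma,\psi)\models T_{\log}$ and let $F:\Psi\to\Psi$ be definable (with parameters) in $(\Gamma,\psi)$. Then there is an increasing sequence $s0=\alpha_0<\alpha_1<\cdots<\alpha_{n-1}<\alpha_n=\infty$ in $\Psi_\infty=\Psi\cup\{\infty\}$ such that for $k=1,\ldots,n$, the restriction of $F$ to $[\alpha_{k-1},\alpha_k)_\Psi=\{x\in\Psi:\alpha_{k-1}\leq x<\alpha_k\}$ is either constant or of the form $x\mapsto s^l(x)$ for some $l\in\mathbb{Z}$.
   Context: Asymptotic couples. An asymptotic couple is a pair $(\Gamma,\psi)$ where $\Gamma$ is a (totally) ordered abelian group and $\psi:\Gamma^{\neq}\to\Gamma$ (with $\Gamma^{\neq}=\Gamma\setminus\{0\}$) satisfies for all $\alpha,\beta\in\Gamma^{\neq}$: (AC1) $\alpha+\beta\neq0\Rightarrow\psi(\alpha+\beta)\geq\min(\psi(\alpha),\psi(\beta))$; (AC2) $\psi(r\alpha)=\psi(\alpha)$ for all nonzero $r\in\mathbb{Z}$; (AC3) $\alpha>0\Rightarrow\alpha+\psi(\alpha)>\psi(\beta)$. It is $H$-asymptotic (of $H$-type) if moreover $0<\alpha\leq\beta\Rightarrow\psi(\alpha)\geq\psi(\beta)$, and divisible if $\Gamma$ is divisible. Put $\Psi=\psi(\Gamma^{\neq})$ and $\gamma'=\gamma+\psi(\gamma)$ for $\gamma\in\Gamma^{\neq}$. $(\Gamma,\psi)$ has asymptotic integration if $\{\gamma':\gamma\in\Gamma^{\neq}\}=\Gamma$; if it is also of $H$-type,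 then for each $\alpha\in\Gamma$ there is a unique $\beta\in\Gamma^{\neq}$ with $\beta'=\alpha$, denoted $\int\alpha$, and the successor function is $s:\Gamma\to\Psi$, $s(\alpha)=\psi(\int\alpha)$; write $s\alpha=s(\alpha)$, so $s0=s(0)$. The theory $T_{\log}$. Let $L_0=\{0,+,-,<,\psi,\infty\}$. An asymptotic couple is an $L_0$-structure with underlying set $\Gamma_\infty=\Gamma\cup\{\infty\}$, $\Gamma<\infty$, and $\infty$ as default value: $-\infty=\gamma+\infty=\infty+\gamma=\infty+\infty=\psi(0)=\psi(\infty)=\infty$. $T_0$ is the $L_0$-theory whose models are the divisible $H$-asymptotic couples with asymptotic integration such that: $\Psi$ has a least element, equal to $s0$, and $s0>0$; every $\alpha\in\Psi$ has an immediate successor in the ordered set $\Psi$, namely $s\alpha$; and $\gamma\mapsto s\gamma:\Psi\to\Psi^{>s0}=\{x\in\Psi:x>s0\}$ is a bijection. For a model of $T_0$ let $p:\Psi^{>s0}\to\Psi$ be the inverse of this bijection, extended to $\Gamma_\infty$ by $p(\alpha)=\infty$ for $\alpha\in\Gamma_\infty\setminus\Psi^{>s0}$. Let $L=L_0\cup\{s,p,\delta_1,\delta_2,\dots\}$ with all new symbols unary function symbols; models of $T_0$ are construed as $L$-structures with $s$ interpreted as the successor function $\alpha\mapsto\psi(\int\alpha)$ on $\Gamma$ and $s(\infty)=\infty$, $p$ interpreted as the function $p:\Gamma_\infty\to\Gamma_\infty$ that inverts $\gamma\mapsto s\gamma:\Psi\to\Psi^{>s0}$ on $\Psi^{>s0}$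 and takes the value $\infty$ elsewhere, and $\delta_n$ interpreted as division by $n$ ($\delta_n(\infty)=\infty$). $T_{\log}$ is the $L$-theory whose models are the models of $T_0$ so construed. Notation. For $x\in\Psi$: $s^0(x)=x$; for $k>0$, $s^k$ is the $k$-fold iterate of $s$; for $k<0$, $s^k(x)=p^{-k}(x)\in\Psi_\infty$. *)

(* Defs.v *)
From mathcomp Require Import all_boot all_order all_algebra.

Set Implicit Arguments.
Unset Strict Implicit.
Unset Printing Implicit Defensive.

Import Order.TTheory GRing.Theory Num.Theory.
Local Open Scope ring_scope.

(* [porderZmodType] only joins a partial order with a group law: totality and
   compatibility are imposed here. *)
Record ordered_abelian_group (G : porderZmodType) : Prop := {
  oag_total : forall x y : G, (x <= y) || (y <= x);
  oag_leD2r : forall x y z : G, x <= y -> x + z <= y + z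
}.

Definition divisible (G : zmodType) : Prop :=
  forall (n : nat) (a : G), (0 < n)%N -> exists b : G, b *+ n = a.

(* Throughout, psi is defined on nonzero elements only; it is represented by a
   total function whose value at 0 is never used. *)
Record asymptotic_couple (G : porderZmodType) (psi : G -> G) : Prop := {
  ac_group : ordered_abelian_group G;
  AC1 : forall a b : G, a != 0 -> b != 0 -> a + b != 0 ->
    Order.min (psi a) (psi b) <= psi (a + b);
  AC2 : forall (r : int) (a : G), r != 0 -> a != 0 -> psi (a *~ r) = psi a;
  AC3 : forall a b : G, a != 0 -> b != 0 -> 0 < a -> psi b < a + psi a
}.

Definition H_type (G : porderZmodType) (psi : G -> G) : Prop :=
  forall a b : G, 0 < a -> a <= b -> psi b <= psi a.

Definition Psi (G : porderZmodType) (psi : G -> G) (x : G) : Prop :=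
  exists2 g : G, g != 0 & psi g = x.

Definition asymptotic_derivative (G : porderZmodType) (psi : G -> G) (g : G) : G :=
  g + psi g.

Definition asymptotic_integration (G : porderZmodType) (psi : G -> G) : Prop :=
  forall a : G, exists2 b : G, b != 0 & asymptotic_derivative psi b = a.

(* s a = psi (int a), where int a is the b != 0 with b' = a. Under H-type and
   asymptotic integration such a b exists and is unique, so this determines s. *)
Definition successor_function (G : porderZmodType) (psi s : G -> G) : Prop :=
  forall a b : G, b != 0 -> asymptotic_derivative psi b = a -> s a = psi b.

Definition immediate_successor (G : porderZmodType) (S : G -> Prop) (x y : G) : Prop :=
  [/\ S y, x < y & forall z : G, S z -> x < z -> y <= z].

Definition Psi_gt_s0 (G : porderZmodType) (psi s : G -> G) (x : G) : Prop :=
  Psi psi x /\ s 0 < x.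

Record models_T0 (G : porderZmodType) (psi s : G -> G) : Prop := {
  T0_couple : asymptotic_couple psi;
  T0_H : H_type psi;
  T0_div : divisible G;
  T0_int : asymptotic_integration psi;
  T0_s : successor_function psi s;
  T0_least : Psi psi (s 0) /\ (forall x : G, Psi psi x -> s 0 <= x);
  T0_s0_gt0 : 0 < s 0;
  T0_succ : forall x : G, Psi psi x -> immediate_successor (Psi psi) x (s x);
  T0_maps : forall x : G, Psi psi x -> Psi_gt_s0 psi s (s x);
  T0_inj : forall x y : G, Psi psi x -> Psi psi y -> s x = s y -> x = y;
  T0_surj : forall y : G, Psi_gt_s0 psi s y -> exists2 x : G, Psi psi x & s x = y
}.

(* Gamma_infty is [option G], with [None] standing for infinity. *)
Definition lt_infty (G : porderZmodType) (x y : option G) : bool :=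
  match x, y with
  | Some a, Some b => a < b
  | Some _, None => true
  | None, _ => false
  end.

Definition le_infty (G : porderZmodType) (x y : option G) : bool :=
  (x == y) || lt_infty x y.

Definition Psi_infty (G : porderZmodType) (psi : G -> G) (x : option G) : Prop :=
  if x is Some a then Psi psi a else True.

(* [ldelta D n] interprets delta_(n+1). *)
Record log_structure (G : porderZmodType) := LogStructure {
  lpsi : G -> G;
  ls : G -> G;
  lp : option G -> option G;
  ldelta : nat -> G -> G
}.

Record models_Tlog (G : porderZmodType) (D : log_structure G) : Prop := {
  Tlog_T0 : models_T0 (lpsi D) (ls D);
  Tlog_p : forall x : G, Psi (lpsi D) x -> lp D (Some (ls D x)) = Some x;
  Tlog_p_default : forall y : option G,
    ~ (exists2 x : G, Psi_gt_s0 (lpsi D) (ls D) x & y = Some x) -> lp D y = None;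
  Tlog_delta : forall (n : nat) (a : G), ldelta D n a *+ n.+1 = a
}.

Inductive Lterm : Type :=
| TVar of nat
| TZero
| TInfty
| TAdd of Lterm & Lterm
| TOpp of Lterm
| TPsi of Lterm
| TS of Lterm
| TP of Lterm
| TDelta of nat & Lterm. (* [TDelta n t] is delta_(n+1)(t) *)

(* Variables are de Bruijn indices; [FEx] and [FAll] bind index 0. *)
Inductive Lformula : Type :=
| FFalse
| FEq of Lterm & Lterm
| FLt of Lterm & Lterm
| FNot of Lformula
| FAnd of Lformula & Lformula
| FOr of Lformula & Lformula
| FImp of Lformula & Lformula
| FEx of Lformula
| FAll of Lformula.

Definition env_cons (U : Type) (x : U) (e : nat -> U) : nat -> U :=
  fun n => if n is m.+1 then e m else x.

Definition add_infty (G : zmodType) (x y : option G) : option G :=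
  if x is Some a then (if y is Some b then Some (a + b) else None) else None.

Definition psi_infty (G : zmodType) (psi : G -> G) (x : option G) : option G :=
  if x is Some a then (if a == 0 then None else Some (psi a)) else None.

Fixpoint eval (G : porderZmodType) (D : log_structure G)
    (e : nat -> option G) (t : Lterm) : option G :=
  match t with
  | TVar n => e n
  | TZero => Some 0
  | TInfty => None
  | TAdd t1 t2 => add_infty (eval D e t1) (eval D e t2)
  | TOpp t1 => omap (fun a : G => - a) (eval D e t1)
  | TPsi t1 => psi_infty (lpsi D) (eval D e t1)
  | TS t1 => omap (ls D) (eval D e t1)
  | TP t1 => lp D (eval D e t1)
  | TDelta n t1 => omap (ldelta D n) (eval D e t1)
  end.

Fixpoint sat (G : porderZmodType) (D : log_structure G)
    (e : nat -> option G) (f : Lformula) : Prop :=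
  match f with
  | FFalse => False
  | FEq t1 t2 => eval D e t1 = eval D e t2
  | FLt t1 t2 => lt_infty (eval D e t1) (eval D e t2)
  | FNot f1 => ~ sat D e f1
  | FAnd f1 f2 => sat D e f1 /\ sat D e f2
  | FOr f1 f2 => sat D e f1 \/ sat D e f2
  | FImp f1 f2 => sat D e f1 -> sat D e f2
  | FEx f1 => exists x : option G, sat D (env_cons x e) f1
  | FAll f1 => forall x : option G, sat D (env_cons x e) f1
  end.

(* Parameters are the values of the environment [e]; a formula mentions only
   finitely many of them. *)
Definition definable2 (G : porderZmodType) (D : log_structure G)
    (R : option G -> option G -> Prop) : Prop :=
  exists (f : Lformula) (e : nat -> option G),
    forall x y : option G, R x y <-> sat D (env_cons x (env_cons y e)) f.

(* A function Psi -> Psi is a total function on G, considered on Psi only: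
   its graph is restricted to Psi. *)
Definition maps_Psi (G : porderZmodType) (psi : G -> G) (F : G -> G) : Prop :=
  forall x : G, Psi psi x -> Psi psi (F x).

Definition definable_on_Psi (G : porderZmodType) (D : log_structure G)
    (F : G -> G) : Prop :=
  definable2 D (fun x y =>
    exists2 a : G, Psi (lpsi D) a & x = Some a /\ y = Some (F a)).

Definition spow (G : porderZmodType) (D : log_structure G) (l : int)
    (x : option G) : option G :=
  match l with
  | Posz k => iter k (omap (ls D)) x
  | Negz k => iter k.+1 (lp D) x
  end.

Definition in_Psi_interval (G : porderZmodType) (psi : G -> G)
    (a b : option G) (x : G) : Prop :=
  [/\ Psi psi x, le_infty a (Some x) & lt_infty (Some x) b].

(* Main.v *)
(* Adjoin to Gamma a formal limit eps of Psi from below (so g < eps for g in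
   Psi), and extend the order and psi to Gamma + Q eps. For g in {0} + Psi the
   element w_g = eps - g is positive of value s g, so w is a section of the
   valuation, and psi, s and p are read off from it: psi(x) = eps - w', where w'
   is the successor of the element of the section with the same value as x, and
   s(x) is obtained in the same way from x - eps. In this language a countable
   partial isomorphism of an ultrapower extends to one more element by
   saturation, the only invariants being the order, the section, and the type of
   the values in their discrete order; hence formulas over Gamma cannot
   distinguish two elements of an ultrapower of Psi with the same cut in the
   countable closure C of the parameters.
   If F x is neither in a fixed finite part of C nor a bounded iterate of s or p
   at x, then along the ultrafilter F x and s(F x) have the same type over x and
   the parameters, which is absurd. Which of these finitely many descriptions of
   F x is valid depends only on the cut of x in C, hence, by the same argument
   along the ultrafilter, on its cut in a finite part of C. *)
Require Import Defs.
From HB Require Import structures.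
From mathcomp Require Import all_boot all_order all_algebra.
From mathcomp Require Import ring boolp filter functions.

Set Implicit Arguments.
Unset Strict Implicit.
Unset Printing Implicit Defensive.

Import Order.TTheory GRing.Theory Num.Theory.
Local Open Scope ring_scope.

(** * Ordered rational spaces with a section of the valuation *)

(** The obstacle is that [psi] takes its values in the group itself: adding one element also adds
    its value, the value of that value, their images under [s] and [p], and so on. The element eps
    breaks this loop. For every b in Gamma the value of e - b is s b for all large e in Psi, so s b
    is the value of b - eps; and for g in {0} + Psi the element eps - g is a canonical
    representative of the value s g. Since s maps {0} + Psi bijectively onto Psi, each value is
    represented exactly once; the index 0 is there because the least value s0 is that of eps itself.
    Formulas are never interpreted in the ultrapower: truth means truth at almost every coordinate,
    and the induction on formulas moves the ultrafilter through connectives and quantifiers, in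
    place of a separate theorem of Los. Quantifiers range over Gamma and infinity, not over Gamma +
    Q eps, so each step of the game must answer an element of Gamma by an element of Gamma; this is
    why [gam] is part of the data. *)

(* [dom x y] says that the value of x is at least that of y, [mark] is the image
   of the section, [nxt] the successor on it, [eps] its element of least value,
   and [gam] is membership in the original group. There is no quotient: [sim]
   below plays the role of equality, so that an ultrapower is a plain space of
   sequences. *)
Record valued_data (V : lmodType rat) := ValuedData {
  pos : V -> Prop;
  dom : V -> V -> Prop;
  mark : V -> Prop;
  nxt : V -> V;
  eps : V;
  gam : V -> Prop
}.

Definition null (V : lmodType rat) (E : valued_data V) (x : V) : Prop :=
  ~ pos E x /\ ~ pos E (- x).
Definition sim (V : lmodType rat) (E : valued_data V) (x y : V) : Prop :=
  null E (x - y).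
Definition eqval (V : lmodType rat) (E : valued_data V) (x y : V) : Prop :=
  dom E x y /\ dom E y x.

(** Weak inequality is written [~ pos E (- x)], so totality of the order is built in and
    [nonneg_add] gives its transitivity. [nxt_lt] says that [nxt E c] has the least value above that
    of c. *)
Record valued_laws (V : lmodType rat) (E : valued_data V) : Prop := {
  pos_asym : forall x, pos E x -> ~ pos E (- x);
  nonneg_add : forall x y, ~ pos E (- x) -> ~ pos E (- y) -> ~ pos E (- (x + y));
  pos_scale : forall q x, 0 < q -> pos E x -> pos E (q *: x);
  dom_total : forall x y, dom E x y \/ dom E y x;
  dom_trans : forall x y z, dom E x y -> dom E y z -> dom E x z;
  dom_add : forall x y z, dom E x z -> dom E y z -> dom E (x + y) z;
  dom_scale : forall q x, dom E (q *: x) x;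
  dom_convex : forall x y, ~ pos E (- x) -> ~ pos E (x - y) -> dom E x y;
  dom_null : forall x y, null E y -> dom E x y -> null E x;
  mark_pos : forall c, mark E c -> pos E c;
  mark_eq : forall c d, mark E c -> mark E d -> eqval E c d -> sim E c d;
  mark_sim : forall c d, mark E c -> sim E c d -> mark E d;
  mark_val : forall x, ~ null E x -> exists2 c, mark E c & eqval E x c;
  nxt_mark : forall c, mark E c -> mark E (nxt E c);
  nxt_lt : forall c d, mark E c -> mark E d -> dom E d (nxt E c) <-> ~ dom E c d;
  eps_mark : mark E (eps E);
  eps_max : forall c, mark E c -> dom E c (eps E);
  nxt_pred : forall c, mark E c ->
    sim E c (eps E) \/ exists2 d, mark E d & sim E c (nxt E d);
  gam_lin : forall q x y, gam E x -> gam E y -> gam E (q *: x + y);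
  gam_sim : forall x y, sim E x y -> gam E x -> gam E y;
  gam_eps : forall c, mark E c -> gam E (c - eps E);
  gam_dense : forall x c, mark E c -> exists2 y, gam E y & ~ dom E c (x - y)
}.

Section ValuedTheory.
Variables (V : lmodType rat) (E : valued_data V) (ax : valued_laws E).
Implicit Types (x y z a b c d : V) (q : rat).

Local Notation pos := (pos E).
Local Notation dom := (dom E).
Local Notation W := (mark E).
Local Notation S := (nxt E).
Local Notation eps := (eps E).
Local Notation gam := (gam E).
Local Notation null := (null E).
Local Notation "x ~~ y" := (sim E x y) (at level 70).
Local Notation "x =~ y" := (eqval E x y) (at level 70).

Lemma pos0 : ~ pos 0.
Proof. by move=> h; apply: (pos_asym ax h); rewrite oppr0. Qed.

Lemma pos_addl x y : pos x -> ~ pos (- y) -> pos (x + y).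
Proof.
move=> px ny; apply: contrapT => n.
have h : ~ pos (- (- (x + y))) by rewrite opprK.
have := nonneg_add ax h ny.
by rewrite (opprD x y) addrNK opprK.
Qed.

Lemma posD x y : pos x -> pos y -> pos (x + y).
Proof. by move=> px py; apply: pos_addl => //; apply: pos_asym. Qed.

Lemma pos_scaleE q x : 0 < q -> pos (q *: x) <-> pos x.
Proof.
move=> q0; split; last exact: pos_scale.
have : 0 < q^-1 by rewrite invr_gt0.
move=> h /(pos_scale ax h); rewrite scalerA mulVf ?scale1r //.
by rewrite gt_eqF.
Qed.

Lemma sign_cases x : [\/ pos x, null x | pos (- x)].
Proof.
case: (pselect (pos x)) => [h|h]; first by constructor 1.
case: (pselect (pos (- x))) => [h'|h']; first by constructor 3.
by constructor 2.
Qed.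

Lemma null0 : null 0.
Proof. by split; rewrite ?oppr0; apply: pos0. Qed.

Lemma nullN x : null x -> null (- x).
Proof. by case=> h1 h2; split; rewrite ?opprK. Qed.

Lemma nullD x y : null x -> null y -> null (x + y).
Proof.
move=> [h1 h2] [h3 h4]; split; last exact: (nonneg_add ax h2 h4).
rewrite -[x + y]opprK opprD; apply: (nonneg_add ax); by rewrite opprK.
Qed.

Lemma nullZ q x : null x -> null (q *: x).
Proof.
move=> zx; have [q0|q0|->] := ltgtP q 0; last by rewrite scale0r; exact: null0.
  rewrite -[q]opprK scaleNr; apply: nullN.
  have h : 0 < - q by rewrite oppr_gt0.
  by split; rewrite -?scalerN (pos_scaleE _ h); case: zx.
by split; rewrite -?scalerN (pos_scaleE _ q0); case: zx.
Qed.

Lemma sim_refl x : x ~~ x.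
Proof. by rewrite /sim subrr; exact: null0. Qed.

Lemma sim_sym x y : x ~~ y -> y ~~ x.
Proof. by move=> /nullN; rewrite opprB. Qed.

Lemma sim_trans x y z : x ~~ y -> y ~~ z -> x ~~ z.
Proof. by move=> h1 h2; have := nullD h1 h2; rewrite subrKA. Qed.

Lemma sim_lin q x y x' y' : x ~~ y -> x' ~~ y' -> (q *: x + x') ~~ (q *: y + y').
Proof.
move=> h1 h2; rewrite /sim opprD addrACA -scalerBr; apply: nullD => //.
exact: nullZ.
Qed.

Lemma simD x y x' y' : x ~~ y -> x' ~~ y' -> (x + x') ~~ (y + y').
Proof. by move=> h1 h2; have := sim_lin 1 h1 h2; rewrite !scale1r. Qed.

Lemma simN x y : x ~~ y -> (- x) ~~ (- y).
Proof. by move=> /nullN; rewrite /sim opprD. Qed.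

Lemma simB x y x' y' : x ~~ y -> x' ~~ y' -> (x - x') ~~ (y - y').
Proof. by move=> h1 /simN; apply: simD. Qed.

Lemma pos_sim x y : x ~~ y -> pos x -> pos y.
Proof.
move=> /sim_sym [_ h] px; have := pos_addl px h; by rewrite addrC subrK.
Qed.

Lemma null_sim x y : x ~~ y -> null x -> null y.
Proof. by move=> /sim_sym h1 h2; rewrite -[y](subrK x); apply: nullD. Qed.

Lemma dom_refl x : dom x x.
Proof. by case: (dom_total ax x x). Qed.

Lemma domN x y : dom x y -> dom (- x) y.
Proof. by move=> h; apply: (dom_trans ax) h; rewrite -scaleN1r; apply: dom_scale. Qed.

Lemma domNr x y : dom x y -> dom x (- y).
Proof. by move=> h; apply: (dom_trans ax) h _; rewrite -{1}[y]opprK; apply/domN/dom_refl. Qed.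

Lemma domB x y z : dom x z -> dom y z -> dom (x - y) z.
Proof. by move=> h1 h2; apply: (dom_add ax) => //; apply: domN. Qed.

Lemma null_dom x y : null x -> dom x y.
Proof.
move=> [h1 h2]; case: (pselect (pos (- y))) => hy.
  have /domNr : dom x (- y); last by rewrite opprK.
  apply: (dom_convex ax) => //; rewrite opprK => h.
  by have := posD h hy; rewrite addrK.
apply: (dom_convex ax) => // h.
by have := pos_addl h hy; rewrite addrNK.
Qed.

Lemma dom_siml x x' y : x ~~ x' -> dom x y -> dom x' y.
Proof.
move=> /sim_sym h1 h2; rewrite -[x'](subrK x); apply: (dom_add ax) => //.
exact: null_dom.
Qed.

Lemma dom_simr x x' y : x ~~ x' -> dom y x -> dom y x'.
Proof. by move=> h1 h2; apply: (dom_trans ax) h2 _; apply: dom_siml (sim_sym h1) (dom_refl _). Qed.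

Lemma eqval_refl x : x =~ x.
Proof. by split; apply: dom_refl. Qed.

Lemma eqval_trans x y z : x =~ y -> y =~ z -> x =~ z.
Proof. by move=> [h1 h2] [h3 h4]; split; [apply: dom_trans h1 h3|apply: dom_trans h4 h2]. Qed.

Lemma eqvalN x : (- x) =~ x.
Proof. by split; [apply/domN/dom_refl|apply/domNr/dom_refl]. Qed.

Lemma eqvalZ q x : q != 0 -> (q *: x) =~ x.
Proof.
move=> q0; split; first exact: (dom_scale ax).
have := dom_scale ax q^-1 (q *: x); by rewrite scalerA mulVf // scale1r.
Qed.

Lemma sim_eqval x y : x ~~ y -> x =~ y.
Proof. by move=> h; split; [apply: dom_simr h _|apply: dom_siml h _]; apply: dom_refl. Qed.

Lemma small_dom x y : ~ dom y x -> dom x y.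
Proof. by case: (dom_total ax x y). Qed.

(** If x could change the sign of y, then y would lie between 0 and x up to sign, and convexity
    would give it at least the value of x. *)
Lemma small_pos x y : ~ dom y x -> pos (x + y) <-> pos y.
Proof.
move=> n; split=> h.
  apply: contrapT => ny; apply: n.
  have /domN : dom (- y) x; last by rewrite opprK.
  apply: (dom_convex ax); first by rewrite opprK.
  by rewrite -opprD addrC; apply: (pos_asym ax).
apply: contrapT => nh; apply: n.
have /domNr : dom y (- x); last by rewrite opprK.
apply: (dom_convex ax); first exact: (pos_asym ax).
by rewrite opprK addrC.
Qed.

Lemma small_eqval x y : ~ dom y x -> (x + y) =~ y.
Proof.
move=> n; split; first by apply: (dom_add ax) (dom_refl _) => //; apply: small_dom.
have [h|h] := dom_total ax x (x + y).
  have := domB (dom_refl (x + y)) h; by rewrite addrAC addrN add0r.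
case: n; have := domB h (dom_refl x); by rewrite addrAC addrN add0r.
Qed.

Lemma null_eqval x y : x =~ y -> null x -> null y.
Proof. by move=> [_ h] z; apply: (dom_null ax) z h. Qed.

Lemma mark_nz c : W c -> ~ null c.
Proof. by move=> /(mark_pos ax) h []. Qed.

Lemma nxt_gt c : W c -> ~ dom c (S c).
Proof. by move=> Wc; rewrite (nxt_lt ax Wc Wc); apply; apply: dom_refl. Qed.

Lemma nxt_dom c d : W c -> W d -> dom (S d) (S c) <-> dom d c.
Proof.
move=> Wc Wd; rewrite (nxt_lt ax Wc (nxt_mark ax Wd)) (nxt_lt ax Wd Wc).
split=> [h|h h']; last exact: h'.
exact: contrapT.
Qed.

Lemma iter_mark k c : W c -> W (iter k S c).
Proof. by move=> Wc; elim: k => //= k; apply: nxt_mark. Qed.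

Lemma iter_dom k c d : W c -> W d -> dom (iter k S d) (iter k S c) <-> dom d c.
Proof.
by move=> Wc Wd; elim: k => //= k <-; apply: nxt_dom; apply: iter_mark.
Qed.

Lemma nxt_le c : W c -> dom (S c) c.
Proof. by move=> Wc; apply: small_dom; apply: nxt_gt. Qed.

Lemma iter_le k c : W c -> dom (iter k S c) c.
Proof.
move=> Wc; elim: k => [|k IH] /=; first exact: dom_refl.
by apply: (dom_trans ax) IH; apply/nxt_le/iter_mark.
Qed.

Lemma iter_gt k c : W c -> dom c (iter k S c) -> k = 0%N.
Proof.
case: k => // k Wc h; case: (nxt_gt (iter_mark k Wc)).
exact: (dom_trans ax) (iter_le _ Wc) h.
Qed.

Lemma nxt_sim c d : W c -> W d -> c ~~ d -> S c ~~ S d.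
Proof.
move=> Wc Wd h; have [h1 h2] := sim_eqval h.
by apply: (mark_eq ax); [apply: nxt_mark|apply: nxt_mark|split; rewrite nxt_dom].
Qed.

Lemma iter_sim k c d : W c -> W d -> c ~~ d -> iter k S c ~~ iter k S d.
Proof.
by move=> Wc Wd h; elim: k => //= k IH; apply: nxt_sim => //; apply: iter_mark.
Qed.

(** Only [eps] lacks a predecessor, so a mark at least k steps above it can be pulled back k
    times. *)
Lemma iter_pred k c : W c -> dom c (iter k S eps) ->
  exists2 d, W d & c ~~ iter k S d.
Proof.
elim: k c => [|k IH] c Wc h; first by exists c => //; apply: sim_refl.
have We := eps_mark ax.
case: (nxt_pred ax Wc) => [ce|[d Wd cd]].
  have := iter_gt We (dom_siml ce h).
  by [].
have h' : dom d (iter k S eps).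
  by rewrite -(nxt_dom (iter_mark _ We) Wd); apply: dom_siml cd h.
have [d' Wd' dd'] := IH _ Wd h'.
exists d' => //=; apply: sim_trans cd _; apply: nxt_sim => //; exact: iter_mark.
Qed.

Lemma ndom_nxt c d : W c -> W d -> dom c d <-> ~ dom d (S c).
Proof.
move=> Wc Wd; rewrite (nxt_lt ax Wc Wd); split; first by move=> h; apply.
exact: contrapT.
Qed.

End ValuedTheory.

(** * Countable partial isomorphisms *)

(* A countable partial isomorphism, given by its graph. *)
Record position (V : lmodType rat) (E : valued_data V) (R : V -> V -> Prop) : Prop := {
  R_eps : R (eps E) (eps E);
  R_lin : forall q x y x' y', R x y -> R x' y' -> R (q *: x + x') (q *: y + y');
  R_sim : forall x y x' y', R x y -> sim E x x' -> sim E y y' -> R x' y';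
  R_pos : forall x y, R x y -> pos E x <-> pos E y;
  R_gam : forall x y, R x y -> gam E x <-> gam E y;
  R_val : forall x y, R x y -> ~ null E x -> exists c c',
    [/\ R c c', mark E c, mark E c', eqval E x c & eqval E y c'];
  R_typ : forall c c' d d', R c c' -> R d d' ->
    mark E c -> mark E c' -> mark E d -> mark E d' ->
    forall k, dom E d (iter k (nxt E) c) <-> dom E d' (iter k (nxt E) c');
  R_cnt : exists f : nat -> V * V, (forall n, R (f n).1 (f n).2) /\
    forall x y, R x y -> exists n, sim E x (f n).1 /\ sim E y (f n).2
}.

Definition ext (V : lmodType rat) (E : valued_data V) (R : V -> V -> Prop)
    (a b x y : V) : Prop :=
  exists q u v, [/\ R u v, sim E x (q *: a + u) & sim E y (q *: b + v)].

Section Positions.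
Variables (V : lmodType rat) (E : valued_data V) (ax : valued_laws E).
Implicit Types (x y z a b c d u v : V) (q : rat) (R : V -> V -> Prop).

Local Notation pos := (pos E).
Local Notation dom := (dom E).
Local Notation W := (mark E).
Local Notation S := (nxt E).
Local Notation eps := (eps E).
Local Notation gam := (gam E).
Local Notation null := (null E).
Local Notation position := (position E).
Local Notation ext := (ext E).
Local Notation "x ~~ y" := (sim E x y) (at level 70).
Local Notation "x =~ y" := (eqval E x y) (at level 70).

Lemma cnt_of (T : countType) (t0 : T) R (f : T -> V * V) :
  (forall t, R (f t).1 (f t).2) ->
  (forall x y, R x y -> exists t, x ~~ (f t).1 /\ y ~~ (f t).2) ->
  exists f : nat -> V * V, (forall n, R (f n).1 (f n).2) /\
    forall x y, R x y -> exists n, x ~~ (f n).1 /\ y ~~ (f n).2.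
Proof.
move=> h1 h2; exists (fun n => f (odflt t0 (unpickle n))); split=> // x y /h2[t ht].
by exists (pickle t); rewrite pickleK.
Qed.

Section OnePosition.
Variables (R : V -> V -> Prop) (pR : position R).

Lemma R_0 : R 0 0.
Proof.
have e := R_eps pR; have := R_lin pR (-1) e e.
by rewrite scaleN1r addNr.
Qed.

Lemma R_scale q x y : R x y -> R (q *: x) (q *: y).
Proof. by move=> h; have := R_lin pR q h R_0; rewrite !addr0. Qed.

Lemma R_add x y x' y' : R x y -> R x' y' -> R (x + x') (y + y').
Proof. by move=> h1 h2; have := R_lin pR 1 h1 h2; rewrite !scale1r. Qed.

Lemma R_opp x y : R x y -> R (- x) (- y).
Proof. by move=> h; have := R_scale (-1) h; rewrite !scaleN1r. Qed.

Lemma R_sub x y x' y' : R x y -> R x' y' -> R (x - x') (y - y').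
Proof. by move=> h1 /R_opp; apply: R_add. Qed.

Lemma R_null x y : R x y -> null x <-> null y.
Proof.
move=> h; have := R_pos pR (R_opp h); have := R_pos pR h.
by rewrite /null => -> ->.
Qed.

Lemma R_simE x y x' y' : R x y -> R x' y' -> x ~~ x' <-> y ~~ y'.
Proof. by move=> h1 h2; apply: R_null; apply: R_sub. Qed.

Lemma R_mark x y : R x y -> W x -> W y.
Proof.
move=> h Wx; have [c [c' [h' Wc Wc' xc yc']]] := R_val pR h (mark_nz ax Wx).
have := mark_eq ax Wx Wc xc; rewrite (R_simE h h') => /sim_sym h2.
exact: (mark_sim ax) Wc' h2.
Qed.

End OnePosition.

(** Exchanging the two sides turns forth into back, so extensions are proved in one direction
    only. *)
Lemma position_inv R : position R -> position (fun x y => R y x).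
Proof.
move=> pR; split.
- exact: R_eps.
- by move=> q x y x1 y1 h1 h2; apply: (R_lin pR).
- by move=> x y x' y' h h1 h2; apply: (R_sim pR) h h2 h1.
- by move=> x y /(R_pos pR) ->.
- by move=> x y /(R_gam pR) ->.
- move=> x y h nz; rewrite -(R_null pR h) in nz.
  by have [c [c' [h1 h2 h3 h4 h5]]] := R_val pR h nz; exists c', c.
- by move=> c c' d d' h1 h2 h3 h4 h5 h6 k; rewrite (R_typ pR h1 h2).
- have [f [f1 f2]] := R_cnt pR; exists (fun n => ((f n).2, (f n).1)); split=> // x y /f2.
  by case=> n [? ?]; exists n.
Qed.

Lemma sub_ext R a b x y : R x y -> ext R a b x y.
Proof. by move=> h; exists 0, x, y; rewrite !scale0r !add0r; split=> //; apply: sim_refl. Qed.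

Lemma mem_ext R a b : position R -> ext R a b a b.
Proof.
move=> pR; exists 1, 0, 0; rewrite !scale1r !addr0; split; try exact: sim_refl.
exact: R_0.
Qed.

Lemma gam_addE x y : gam x -> gam (x + y) <-> gam y.
Proof.
move=> gx; split=> h; last by have := gam_lin ax 1 gx h; rewrite scale1r.
by have := gam_lin ax (-1) gx h; rewrite scaleN1r addKr.
Qed.

Lemma gam0 : gam 0.
Proof. by have := gam_eps ax (eps_mark ax); rewrite subrr. Qed.

Lemma gamZ q x : gam x -> gam (q *: x).
Proof. by move=> h; have := gam_lin ax q h gam0; rewrite addr0. Qed.

Lemma gam_simE x y : x ~~ y -> gam x <-> gam y.
Proof. by move=> h; split; apply: (gam_sim ax) => //; apply: sim_sym. Qed.

Lemma pos_simE x y : x ~~ y -> pos x <-> pos y.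
Proof. by move=> h; split; apply: (pos_sim ax) => //; apply: sim_sym. Qed.

Lemma null_simE x y : x ~~ y -> null x <-> null y.
Proof. by move=> h; split; apply: (null_sim ax) => //; apply: sim_sym. Qed.

Lemma factor_out q a u : q != 0 -> q *: a + u = q *: (a - (- q^-1) *: u).
Proof.
by move=> q0; rewrite scaleNr opprK scalerDr scalerA divff // scale1r.
Qed.

(** An element q a + u with q nonzero is q times a difference a - u', so signs and values need
    checking only on R and on these differences. T collects the marks that occur as values; every
    mark of the extension is [sim] to one of them, so types need comparing only on T. For [gam] one
    difference lying in the group on both sides is enough. *)
Lemma ext_position R a b (T : V -> V -> Prop) : position R ->
  (forall u v, R u v -> (pos (a - u) <-> pos (b - v)) /\ (pos (u - a) <-> pos (v - b))) ->
  (exists u v, [/\ R u v, gam (a - u) & gam (b - v)]) ->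
  (forall c c', T c c' -> [/\ W c, W c' & ext R a b c c']) ->
  (forall u v, R u v -> ~ null u -> exists c c', [/\ T c c', u =~ c & v =~ c']) ->
  (forall u v, R u v -> ~ null (a - u) ->
     exists c c', [/\ T c c', a - u =~ c & b - v =~ c']) ->
  (forall c c' d d', T c c' -> T d d' ->
     forall k, dom d (iter k S c) <-> dom d' (iter k S c')) ->
  position (ext R a b).
Proof.
move=> pR H1 [u0 [v0 [R0 ga gb]]] TW Tv Ta Tt.
have val x y : ext R a b x y -> ~ null x ->
    exists c c', [/\ T c c', x =~ c & y =~ c'].
  move=> [q [u [v [Ruv xe ye]]]]; rewrite (null_simE xe) => nz.
  suff [c [c' [Tc h1 h2]]] : exists c c',
      [/\ T c c', q *: a + u =~ c & q *: b + v =~ c'].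
    exists c, c'; split=> //; first exact: (eqval_trans ax) (sim_eqval ax xe) h1.
    exact: (eqval_trans ax) (sim_eqval ax ye) h2.
  have [q0|q0] := eqVneq q 0.
    by move: nz; rewrite q0 !scale0r !add0r; apply: Tv.
  move: nz; rewrite !factor_out // => nz.
  have R' := R_scale pR (- q^-1) Ruv.
  have nz' : ~ null (a - - q^-1 *: u) by move=> h; apply: nz; apply: nullZ.
  have [c [c' [Tc h1 h2]]] := Ta _ _ R' nz'.
  exists c, c'; split=> //; first exact: (eqval_trans ax) (eqvalZ ax _ q0) h1.
  exact: (eqval_trans ax) (eqvalZ ax _ q0) h2.
split.
- exact: (sub_ext _ _ (R_eps pR)).
- move=> q x y x' y' [p [u [v [h1 h2 h3]]]] [p' [u' [v' [h1' h2' h3']]]].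
  exists (q * p + p'), (q *: u + u'), (q *: v + v'); split.
  + exact: (R_lin pR).
  + by have := sim_lin ax q h2 h2'; rewrite scalerDr scalerA addrACA -scalerDl.
  + by have := sim_lin ax q h3 h3'; rewrite scalerDr scalerA addrACA -scalerDl.
- move=> x y x' y' [p [u [v [h1 h2 h3]]]] xx yy; exists p, u, v; split=> //.
    exact: (sim_trans ax) (sim_sym xx) h2.
  exact: (sim_trans ax) (sim_sym yy) h3.
- move=> x y [q [u [v [Ruv xe ye]]]]; rewrite (pos_simE xe) (pos_simE ye).
  have [q0|q0|->] := ltgtP q 0; last by rewrite !scale0r !add0r; apply: R_pos Ruv.
  + have q1 : 0 < - q by rewrite oppr_gt0.
    rewrite !factor_out ?lt_eqF // -2!(opprB (_ *: _)) 2!scalerN -2!scaleNr.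
    by rewrite !pos_scaleE //; case: (H1 _ _ (R_scale pR (- q^-1) Ruv)).
  + rewrite !factor_out ?gt_eqF // !pos_scaleE //.
    by case: (H1 _ _ (R_scale pR (- q^-1) Ruv)).
- move=> x y [q [u [v [Ruv xe ye]]]]; rewrite (gam_simE xe) (gam_simE ye).
  have e a' w w' : q *: a' + w = q *: (a' - w') + (q *: w' + w).
    by rewrite addrA -scalerDr subrK.
  rewrite (e a u u0) (e b v v0) (gam_addE _ (gamZ q ga)) (gam_addE _ (gamZ q gb)).
  exact: (R_gam pR (R_lin pR q R0 Ruv)).
- move=> x y h nz; have [c [c' [Tc h1 h2]]] := val _ _ h nz.
  by have [? ? ?] := TW _ _ Tc; exists c, c'.
- move=> c c' d d' h1 h2 Wc Wc' Wd Wd' k.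
  have [c1 [c1' [Tc1 a1 a2]]] := val _ _ h1 (mark_nz ax Wc).
  have [d1 [d1' [Td1 a3 a4]]] := val _ _ h2 (mark_nz ax Wd).
  have [Wc1 Wc1' _] := TW _ _ Tc1; have [Wd1 Wd1' _] := TW _ _ Td1.
  have s1 := iter_sim ax k Wc Wc1 (mark_eq ax Wc Wc1 a1).
  have s2 := iter_sim ax k Wc' Wc1' (mark_eq ax Wc' Wc1' a2).
  have [e1 e2] := sim_eqval ax s1; have [e3 e4] := sim_eqval ax s2.
  case: a3 a4 => [e5 e6] [e7 e8]; have H := Tt _ _ _ _ Tc1 Td1 k; split=> h.
    apply: (dom_trans ax) e7 _; apply: (dom_trans ax) _ e4.
    by apply/H => //; apply: (dom_trans ax) e6 _; apply: (dom_trans ax) h _.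
  apply: (dom_trans ax) e5 _; apply: (dom_trans ax) _ e2.
  by apply/H => //; apply: (dom_trans ax) e8 _; apply: (dom_trans ax) h _.
- have [f [f1 f2]] := R_cnt pR.
  apply: (@cnt_of (rat * nat)%type (0, 0%N) _
     (fun t => (t.1 *: a + (f t.2).1, t.1 *: b + (f t.2).2))).
    by move=> [q n] /=; exists q, (f n).1, (f n).2; split=> //; apply: sim_refl.
  move=> x y [q [u [v [/f2[n [h1 h2]] h3 h4]]]]; exists (q, n) => /=; split.
    apply: (sim_trans ax) h3 _; apply: (simD ax) h1; exact: sim_refl.
  apply: (sim_trans ax) h4 _; apply: (simD ax) h2; exact: sim_refl.
Qed.

End Positions.

(** I stands for the class of internal conditions. Its clauses are the forms of condition imposed on
    a new element below, which keeps the extension arguments independent of the ultrapower. *)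
Record saturated (V : lmodType rat) (E : valued_data V)
    (I : (V -> Prop) -> Prop) : Prop := {
  I_imp : forall (A : Prop) P, I P -> I (fun b => A -> P b);
  I_and : forall P Q, I P -> I Q -> I (fun b => P b /\ Q b);
  I_posl : forall v, I (fun b => pos E (b - v));
  I_posr : forall v, I (fun b => pos E (v - b));
  I_doml : forall v c, I (fun b => dom E (b - v) c);
  I_domr : forall v c, I (fun b => dom E c (b - v));
  I_mark : I (mark E);
  I_gam : I (gam E);
  I_iterl : forall k c, I (fun b => dom E b (iter k (nxt E) c));
  I_iterr : forall k c, I (fun b => dom E c (iter k (nxt E) b));
  saturation : forall P : nat -> V -> Prop, (forall n, I (P n)) ->
    (forall N, exists b, forall n, (n <= N)%N -> P n b) ->
    exists b, forall n, P n b
}.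

(** * Extension of a partial isomorphism by a mark *)

Section Extensions.
Variables (V : lmodType rat) (E : valued_data V) (ax : valued_laws E).
Implicit Types (x y z a b c d u v : V) (q : rat) (R : V -> V -> Prop).

Local Notation pos := (pos E).
Local Notation dom := (dom E).
Local Notation W := (mark E).
Local Notation S := (nxt E).
Local Notation eps := (eps E).
Local Notation gam := (gam E).
Local Notation null := (null E).
Local Notation position := (position E).
Local Notation ext := (ext E).
Local Notation "x ~~ y" := (sim E x y) (at level 70).
Local Notation "x =~ y" := (eqval E x y) (at level 70).

Definition same_type R j j' := forall c c', R c c' -> W c -> W c' -> forall k,
  (dom j (iter k S c) <-> dom j' (iter k S c')) /\
  (dom c (iter k S j) <-> dom c' (iter k S j')).

(** If no mark of R has the value of j, then j and any u in the domain have different values, and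
    the dominating one decides sign and value of j - u. The last clause, that j is the only new
    mark, is what allows types over R' to be computed when a second mark is added. *)
Lemma add_mark R j j' : position R -> W j -> W j' -> same_type R j j' ->
  exists R', [/\ position R', (forall x y, R x y -> R' x y), R' j j' &
    forall x y, R' x y -> W x ->
      (exists c c', [/\ R c c', W c, x ~~ c & y ~~ c']) \/ (x ~~ j /\ y ~~ j')].
Proof.
move=> pR Wj Wj' H.
case: (pselect (exists c c', [/\ R c c', W c & c ~~ j])) => [[c [c' [h1 h2 h3]]]|no].
  exists R; split=> // [|x y Rxy Wx]; last first.
    by left; exists x, y; split=> //; apply: sim_refl.
  have h4 := R_mark ax pR h1 h2.
  have [[e1 _] [e2 _]] := H _ _ h1 h2 h4 0%N; have [e3 e4] := sim_eqval ax h3.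
  apply: (R_sim pR) h1 h3 _; apply: (mark_eq ax) => //; split; [exact: e2|exact: e1].
have str u v : R u v -> (~ dom j u /\ ~ dom j' v) \/ (~ dom u j /\ ~ dom v j').
  move=> Ruv; case: (pselect (null u)) => zu.
    have zv : null v by rewrite -(R_null pR Ruv).
    by left; split=> h; [apply: (mark_nz ax Wj)|apply: (mark_nz ax Wj')];
      apply: (dom_null ax) h.
  have [c [c' [h1 h2 h3 [h4 h4'] [h5 h5']]]] := R_val pR Ruv zu.
  have [e1 e2] := H _ _ h1 h2 h3 0%N; rewrite /= in e1 e2.
  case: (pselect (dom j c)) => jc.
    right; split=> h; first by apply: no; exists c, c'; split=> //;
      apply: (mark_eq ax) => //; split=> //; exact: (dom_trans ax) h4' h.
    apply: no; exists c, c'; split=> //.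
    apply: (mark_eq ax) => //; split=> //; apply/e2.
    exact: (dom_trans ax) h5' h.
  left; split=> h; first by apply: jc; apply: (dom_trans ax) h h4.
  by apply: jc; apply/e1; apply: (dom_trans ax) h h5.
have W1 := mark_pos ax Wj; have W1' := mark_pos ax Wj'.
pose T c c' := [/\ R c c', W c & W c'] \/ (c = j /\ c' = j').
have pR' : position (ext R j j').
  apply: (ext_position ax (T := T) pR) => [u v Ruv||c c'|u v Ruv zu|u v Ruv zu|c c' d d'].
  - case: (str _ _ Ruv) => [[h1 h2]|[h1 h2]]; split.
    + rewrite addrC (small_pos ax (y := j)); last by move=> /(domNr ax); rewrite opprK.
      by rewrite addrC small_pos //; move=> /(domNr ax); rewrite opprK.
    + rewrite (small_pos ax (y := - j)); last by move=> /(domN ax); rewrite opprK.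
      rewrite (small_pos ax (y := - j')); last by move=> /(domN ax); rewrite opprK.
      by split=> /(pos_asym ax); rewrite opprK.
    + rewrite (small_pos ax (y := - u)); last by move=> /(domN ax); rewrite opprK.
      rewrite (small_pos ax (y := - v)); last by move=> /(domN ax); rewrite opprK.
      exact: (R_pos pR (R_opp pR Ruv)).
    + rewrite addrC (small_pos ax (y := u)); last by move=> /(domNr ax); rewrite opprK.
      rewrite addrC (small_pos ax (y := v)); last by move=> /(domNr ax); rewrite opprK.
      exact: R_pos pR _ _ Ruv.
  - by exists eps, eps; split; [apply: R_eps|apply: gam_eps|apply: gam_eps].
  - by case=> [[h1 h2 h3]|[-> ->]]; split=> //; [apply: sub_ext|apply: mem_ext].
  - have [c [c' [h1 h2 h3 h4 h5]]] := R_val pR Ruv zu.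
    by exists c, c'; split=> //; left.
  - case: (str _ _ Ruv) => [[h1 h2]|[h1 h2]].
      exists j, j'; split; first by right.
        rewrite addrC; apply: (small_eqval ax).
        by move=> /(domNr ax); rewrite opprK.
      rewrite addrC; apply: (small_eqval ax).
      by move=> /(domNr ax); rewrite opprK.
    have nu : ~ null u by move=> h; apply: h1; apply: null_dom.
    have [c [c' [h1' h2' h3' h4 h5]]] := R_val pR Ruv nu.
    exists c, c'; split; first by left.
      apply: (eqval_trans ax) h4; apply: (eqval_trans ax) (eqvalN ax _).
      by apply: (small_eqval ax) => /(domN ax); rewrite opprK.
    apply: (eqval_trans ax) h5; apply: (eqval_trans ax) (eqvalN ax _).
    by apply: (small_eqval ax) => /(domN ax); rewrite opprK.
  - case=> [[h1 h2 h3]|[-> ->]]; case=> [[h1' h2' h3']|[-> ->]] k.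
    + exact: (R_typ pR).
    + by have [h _] := H _ _ h1 h2 h3 k.
    + by have [_ h] := H _ _ h1' h2' h3' k.
    + split=> /iter_gt -> //; exact: dom_refl.
exists (ext R j j'); split=> //; [exact: sub_ext|exact: mem_ext|].
move=> x y Rxy Wx; case: (pselect (x ~~ j)) => xj.
  by right; split=> //; rewrite -(R_simE pR' Rxy (mem_ext ax _ _ pR)).
left; have [q [u [v [Ruv xe ye]]]] := Rxy.
have Wy := R_mark ax pR' Rxy Wx.
suff [c [c' [h1 h2 h3]]] : exists c c', [/\ R c c', W c & x ~~ c].
  exists c, c'; split=> //.
  by rewrite -(R_simE pR' Rxy (sub_ext ax _ _ h1)).
have [q0|q0] := eqVneq q 0.
  move: xe; rewrite q0 scale0r add0r => xe; exists u, v; split=> //.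
  exact: (mark_sim ax) Wx xe.
move: xe; rewrite factor_out // => xe.
have R' := R_scale pR (- q^-1) Ruv.
have xa : x =~ j - - q^-1 *: u.
  exact: (eqval_trans ax) (sim_eqval ax xe) (eqvalZ ax _ q0).
case: (str _ _ R') => [[h1 h2]|[h1 h2]].
  case: xj; apply: (mark_eq ax) => //; apply: (eqval_trans ax) xa _.
  by rewrite addrC; apply: (small_eqval ax) => /(domNr ax); rewrite opprK.
set u' := _ *: u in R' xa h1; set v' := _ *: v in R' h2.
have nu : ~ null u' by move=> h; apply: h1; apply: null_dom.
have [c [c' [h1' h2' h3' h4 h5]]] := R_val pR R' nu.
exists c, c'; split=> //; apply: (mark_eq ax) => //; apply: (eqval_trans ax) xa _.
apply: (eqval_trans ax) h4; apply: (eqval_trans ax) (eqvalN ax _).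
by apply: (small_eqval ax) => /(domN ax); rewrite opprK.
Qed.

Lemma argmax (p : nat -> Prop) (r : nat -> nat -> Prop) N :
  (forall m n, r m n \/ r n m) -> (forall l m n, r l m -> r m n -> r l n) ->
  (exists2 n, (n <= N)%N & p n) ->
  exists m, [/\ (m <= N)%N, p m & forall n, (n <= N)%N -> p n -> r m n].
Proof.
move=> tot tr; have rr n : r n n by case: (tot n n).
elim: N => [|N IH] [n nN pn].
  move: nN pn; rewrite leqn0 => /eqP -> p0; exists 0%N; split=> // m.
  by rewrite leqn0 => /eqP ->.
case: (pselect (exists2 n, (n <= N)%N & p n)) => [/IH[m [mN pm hm]]|no]; last first.
  have nE k : (k <= N.+1)%N -> p k -> k = N.+1.
    rewrite leq_eqVlt => /orP[/eqP //|kN pk]; by case: no; exists k.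
  exists n; split=> // k kN pk; by rewrite (nE _ nN pn) (nE _ kN pk).
case: (pselect (p N.+1 /\ r N.+1 m)) => [[p1 r1]|h].
  exists N.+1; split=> // k; rewrite leq_eqVlt => /orP[/eqP -> //|kN pk].
  exact: tr r1 (hm _ kN pk).
exists m; split=> //; first exact: leqW.
move=> k; rewrite leq_eqVlt => /orP[/eqP -> p1|kN pk]; last exact: hm.
case: (tot N.+1 m) => // r1; by case: h.
Qed.

Variables (I : (V -> Prop) -> Prop) (sat : saturated E I).

Lemma dom_simE x y x' y' : x ~~ x' -> y ~~ y' -> dom x y <-> dom x' y'.
Proof.
move=> h1 h2; split=> h; first exact: (dom_siml ax) h1 (dom_simr ax h2 h).
exact: (dom_siml ax) (sim_sym h1) (dom_simr ax (sim_sym h2) h).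
Qed.

Lemma R_typ2 R c c' d d' m n : position R -> R c c' -> R d d' -> W c -> W d ->
  dom (iter m S d) (iter n S c) <-> dom (iter m S d') (iter n S c').
Proof.
move=> pR h1 h2 Wc Wd; have Wc' := R_mark ax pR h1 Wc; have Wd' := R_mark ax pR h2 Wd.
have lt k e e' : W e -> W e' -> dom (iter k S e) e' <-> ~ dom e' (iter k.+1 S e).
  by move=> We We'; apply: (ndom_nxt ax) => //; apply: iter_mark.
have [mn|/ltnW nm] := leqP m n.
  rewrite -(subnKC mn) !iterD !(iter_dom ax) //; try exact: (iter_mark ax).
  exact: (R_typ pR).
rewrite -(subnKC nm) !iterD !(iter_dom ax) //; try exact: (iter_mark ax).
rewrite !lt //.
by have := R_typ pR h2 h1 Wd Wd' Wc Wc' (m - n).+1 => /= ->.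
Qed.

Lemma I_ball (P : nat -> V -> Prop) N : (forall n, I (P n)) ->
  I (fun b => forall n, (n <= N)%N -> P n b).
Proof.
move=> IP; elim: N => [|N IH].
  suff -> : (fun b => forall n, (n <= 0)%N -> P n b) = P 0%N by [].
  apply/funext => b; apply/propext; split=> [|h n]; first exact.
  by rewrite leqn0 => /eqP ->.
suff -> : (fun b => forall n, (n <= N.+1)%N -> P n b) =
          (fun b => (forall n, (n <= N)%N -> P n b) /\ P N.+1 b).
  exact: (I_and sat).
apply/funext => b; apply/propext; split=> [h|[h h'] n].
  by split=> [n nN|]; apply: h => //; exact: leqW.
by rewrite leq_eqVlt => /orP[/eqP -> //|/h].
Qed.

(** Either j is finitely many steps above a mark of the domain, or finitely many below one, or
    infinitely far from all of them. In the second case the required predecessors exist on the other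
    side because R fixes [eps] and preserves being k steps above it. Only the third case needs
    saturation. *)
Lemma find_mark R j : position R -> W j -> exists2 j', W j' & same_type R j j'.
Proof.
move=> pR Wj; have We := eps_mark ax; have iterW := iter_mark ax.
case: (pselect (exists c c' k, [/\ R c c', W c & j ~~ iter k S c])).
  move=> [c [c' [k [h1 h2 h3]]]]; have h2' := R_mark ax pR h1 h2.
  exists (iter k S c'); first exact: iterW.
  move=> d d' Rd Wd Wd' m; split.
    by rewrite (dom_simE h3 (sim_refl ax _)) (R_typ2 _ _ pR Rd h1).
  rewrite (dom_simE (sim_refl ax d) (iter_sim ax m Wj (iterW _ _ h2) h3)) -!iterD.
  exact: (R_typ pR).
case: (pselect (exists c c' k, [/\ R c c', W c & c ~~ iter k S j])).
  move=> [c [c' [k [h1 h2 h3]]]] _; have h2' := R_mark ax pR h1 h2.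
  have : dom c' (iter k S eps).
    rewrite -(R_typ pR (R_eps pR) h1) // (dom_simE h3 (sim_refl ax _)).
    by rewrite (iter_dom ax) //; apply: (eps_max ax).
  move=> /(iter_pred ax h2')[j' Wj' h4]; exists j' => //.
  move=> d d' Rd Wd Wd' m; split.
    rewrite -(iter_dom ax k) // -?iterD; last exact: iterW.
    rewrite -[X in _ <-> X](iter_dom ax k) // -?iterD; last exact: iterW.
    rewrite -(dom_simE h3 (sim_refl ax _)) -(dom_simE h4 (sim_refl ax _)).
    exact: (R_typ2 0 _ pR Rd h1).
  rewrite -(iter_dom ax k) // -?iterD; last exact: iterW.
  rewrite -[X in _ <-> X](iter_dom ax k) // -?iterD; last exact: iterW.
  rewrite addnC !iterD.
  rewrite -(dom_simE (sim_refl ax _) (iter_sim ax m h2 (iterW _ _ Wj) h3)).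
  rewrite -(dom_simE (sim_refl ax _) (iter_sim ax m h2' (iterW _ _ Wj') h4)).
  exact: (R_typ2 _ _ pR h1 Rd).
move=> no2 no1.
(* With finite distances excluded, lying on one side of c already means lying beyond all its
   iterates on that side. *)
have far c c' : R c c' -> W c ->
    (forall k, dom j (iter k S c) /\ ~ dom c (iter k S j)) \/
    (forall k, dom c (iter k S j) /\ ~ dom j (iter k S c)).
  move=> h1 h2.
  have step1 k : dom j (iter k S c) -> dom j (iter k.+1 S c).
    move=> h; rewrite /= (nxt_lt ax (iterW _ _ h2) Wj) => h'; apply: no1.
    by exists c, c', k; split=> //; apply: (mark_eq ax) => //; exact: iterW.
  have step2 k : dom c (iter k S j) -> dom c (iter k.+1 S j).
    move=> h; rewrite /= (nxt_lt ax (iterW _ _ Wj) h2) => h'; apply: no2.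
    by exists c, c', k; split=> //; apply: (mark_eq ax) => //; exact: iterW.
  have [jc|cj] := dom_total ax j c; [left|right] => k.
    have H m : dom j (iter m S c) by elim: m => // m; apply: step1.
    split=> // h; have /= := H 1%N; rewrite (nxt_lt ax h2 Wj); apply.
    by apply: (dom_trans ax) h _; apply: (iter_le ax).
  have H m : dom c (iter m S j) by elim: m => // m; apply: step2.
  split=> // h; have /= := H 1%N; rewrite (nxt_lt ax Wj h2); apply.
  by apply: (dom_trans ax) h _; apply: (iter_le ax).
have [f [f1 f2]] := R_cnt pR.
(* Condition N asks for N steps of distance from the listed marks of index at most N; all conditions
   together give infinite distance from every mark. *)
pose P N j' := W j' /\ forall n, (n <= N)%N -> W (f n).1 ->
  (dom j (f n).1 -> dom j' (iter N S (f n).2)) /\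
  (~ dom j (f n).1 -> dom (f n).2 (iter N S j')).
have IP N : I (P N).
  apply: (I_and sat); first exact: (I_mark sat).
  by apply: I_ball => n; apply: (I_imp sat); apply: (I_and sat);
    apply: (I_imp sat); [exact: I_iterl|exact: I_iterr].
have fW n : W (f n).1 -> W (f n).2 by move=> h; apply: (R_mark ax pR (f1 n) h).
have cl n k : W (f n).1 -> dom j (f n).1 -> dom j (iter k S (f n).1).
  move=> Wn jn; case: (far _ _ (f1 n) Wn) => h; first by have [] := h k.
  by have [_] := h 0%N.
have [m0 [e1 e2]] := f2 _ _ (R_eps pR).
have Wm0 : W (f m0).1 by apply: (mark_sim ax) We e1.
have [|j' Pj'] := saturation sat IP; last first.
  have Wj' : W j' by case: (Pj' 0%N).
  have shr d e N k : W e -> (k <= N)%N -> dom d (iter N S e) -> dom d (iter k S e).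
    move=> We' kN h; apply: (dom_trans ax) h _; rewrite -(subnK kN) iterD.
    by apply: (iter_le ax); apply: iterW.
  have key1 n k : W (f n).1 -> dom j (f n).1 -> dom j' (iter k S (f n).2).
    move=> Wn h; have [_ /(_ n)] := Pj' (maxn n k).
    rewrite leq_maxl => /(_ isT Wn)[/(_ h) g _].
    by apply: shr g; [apply: fW|rewrite leq_maxr].
  have key2 n k : W (f n).1 -> ~ dom j (f n).1 -> dom (f n).2 (iter k S j').
    move=> Wn h; have [_ /(_ n)] := Pj' (maxn n k).
    rewrite leq_maxl => /(_ isT Wn)[_ /(_ h) g].
    by apply: shr g; last rewrite leq_maxr.
  exists j' => // c c' Rc Wc Wc' k.
  have [n [cn cn']] := f2 _ _ Rc.
  have Wn : W (f n).1 := mark_sim ax Wc cn; have Wn' := fW _ Wn.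
  rewrite (dom_simE cn (sim_refl ax _)) (dom_simE cn' (sim_refl ax _)).
  rewrite (dom_simE (sim_refl ax j) (iter_sim ax k Wc Wn cn)).
  rewrite (dom_simE (sim_refl ax j') (iter_sim ax k Wc' Wn' cn')).
  case: (far _ _ (f1 n) Wn) => h.
    have jn : dom j (f n).1 by have [] := h 0%N.
    have [g1 g2] := h k; split; split=> // h'; first exact: key1.
    have /= := key1 _ 1%N Wn jn; rewrite (nxt_lt ax) // => h''; case: h''.
    by apply: (dom_trans ax) h' _; apply: (iter_le ax).
  have jn : ~ dom j (f n).1 by have [] := h 0%N.
  have [g1 g2] := h k; split; split=> // h'; last exact: key2.
  have /= := key2 _ 1%N Wn jn; rewrite (nxt_lt ax) // => h''; case: h''.
  by apply: (dom_trans ax) h' _; apply: (iter_le ax).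
(* [m0] is an index of [eps], so some listed mark lies below j. Take M steps above the image of the
   largest such mark: the marks above j are infinitely far from it, so their images leave room for M
   steps and more. *)
move=> N; pose M := maxn N m0.
pose p n := W (f n).1 /\ dom j (f n).1.
have [|||m [mM [Wm jm] hm]] := @argmax p (fun m n => dom (f m).1 (f n).1) M.
- by move=> m n; apply: (dom_total ax).
- by move=> l m n; apply: (dom_trans ax).
- exists m0; first by rewrite leq_maxr.
  by split=> //; apply: (dom_simr ax e1); apply: (eps_max ax).
exists (iter M S (f m).2) => n nN; split; first exact: iterW (fW _ Wm).
move=> k kn Wk; have kM : (k <= M)%N.
  by rewrite leq_max (leq_trans kn nN).
have nM : (n <= M)%N by rewrite leq_max nN.
split=> h.
  apply: (dom_trans ax (y := iter n S (f m).2)).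
    by rewrite -(subnK nM) iterD; apply: (iter_le ax); apply: iterW; apply: fW.
  rewrite (iter_dom ax) //; try exact: fW.
  by apply/(R_typ pR (f1 k) (f1 m) Wk (fW _ Wk) Wm (fW _ Wm) 0); apply: hm.
rewrite -iterD; apply/(R_typ pR (f1 m) (f1 k) Wm (fW _ Wm) Wk (fW _ Wk)).
have jS := cl m (n + M)%N Wm jm.
apply: (dom_trans ax) jS; exact: (small_dom ax).
Qed.

End Extensions.

(** * Extension of a partial isomorphism by a group element *)

Section Forth.
Variables (V : lmodType rat) (E : valued_data V) (ax : valued_laws E).
Variables (I : (V -> Prop) -> Prop) (sat : saturated E I).
Implicit Types (x y z a b c d u v : V) (q : rat) (R : V -> V -> Prop).

Local Notation pos := (pos E).
Local Notation dom := (dom E).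
Local Notation W := (mark E).
Local Notation S := (nxt E).
Local Notation eps := (eps E).
Local Notation gam := (gam E).
Local Notation null := (null E).
Local Notation position := (position E).
Local Notation ext := (ext E).
Local Notation "x ~~ y" := (sim E x y) (at level 70).
Local Notation "x =~ y" := (eqval E x y) (at level 70).

Lemma extend_mark R j : position R -> W j ->
  exists R' j', [/\ position R', (forall x y, R x y -> R' x y), R' j j' & W j'].
Proof.
move=> pR Wj; have [j' Wj' H] := find_mark ax sat pR Wj.
by have [R' [h1 h2 h3 _]] := add_mark ax pR Wj Wj' H; exists R', j'.
Qed.

(* At most one value of a - u, u in the domain, is not yet in the domain: once it
   is added, every other difference a - u has a value there too. *)
Lemma close_step R a : position R -> exists R1, [/\ position R1,
  (forall x y, R x y -> R1 x y) &
  forall u v, R u v -> ~ null (a - u) -> exists c c', [/\ R1 c c', W c & a - u =~ c]].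
Proof.
move=> pR.
case: (pselect (forall u v, R u v -> ~ null (a - u) ->
    exists c c', [/\ R c c', W c & a - u =~ c])) => [h|]; first by exists R.
move=> /existsNP[u0] /existsNP[v0] /not_implyP[R0 /not_implyP[nz no]].
have [j Wj aj] := mark_val ax nz.
have [R1 [j' [pR1 sub Rj Wj']]] := extend_mark pR Wj.
exists R1; split=> // u v Ruv nzu.
have e : a - u = (a - u0) + (u0 - u) by rewrite subrKA.
case: (pselect (null (u0 - u))) => z.
  exists j, j'; split=> //; apply: (eqval_trans ax) aj; apply: (sim_eqval ax).
  by rewrite /sim e addrAC addrN add0r.
have [d [d' [Rd Wd Wd' ud _]]] := R_val pR (R_sub pR R0 Ruv) z.
have [h|h] := pselect (dom (a - u0) (u0 - u)).
  exists d, d'; split=> //; first exact: sub.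
  apply: (eqval_trans ax) (ud); rewrite e; apply: (small_eqval ax) => h'.
  apply: no; exists d, d'; split=> //; apply: (eqval_trans ax) ud; by split.
exists j, j'; split=> //; apply: (eqval_trans ax) aj.
by rewrite e addrC; apply: (small_eqval ax).
Qed.

(** One closing step treats only the u of the old domain while enlarging it. The union of countably
    many steps is closed, and still countable. *)
Lemma close_chain R a : position R -> exists R1, [/\ position R1,
  (forall x y, R x y -> R1 x y) &
  forall u v, R1 u v -> ~ null (a - u) -> exists c c', [/\ R1 c c', W c & a - u =~ c]].
Proof.
move=> pR; pose P := {R | position R}.
have /choice[nx hnx] : forall s : P, exists s' : P,
    (forall x y, sval s x y -> sval s' x y) /\
    forall u v, sval s u v -> ~ null (a - u) ->
      exists c c', [/\ sval s' c c', W c & a - u =~ c].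
  by move=> [Q pQ]; have [Q' [h1 h2 h3]] := close_step a pQ; exists (exist _ Q' h1).
pose s n : P := iter n nx (exist _ R pR).
have mono m n x y : (m <= n)%N -> sval (s m) x y -> sval (s n) x y.
  move=> mn; rewrite -(subnK mn); elim: (n - m)%N => // k IH /IH.
  by have [h _] := hnx (s (k + m)%N); apply: h.
have pos_ n : position (sval (s n)) := svalP (s n).
pose Q x y := exists n, sval (s n) x y.
exists Q; split; last first.
- move=> u v [n h] nz; have [_ h'] := hnx (s n).
  have [c [c' [h1 h2 h3]]] := h' _ _ h nz.
  by exists c, c'; split=> //; exists n.+1.
- by move=> x y h; exists 0%N.
split.
- by exists 0%N; apply: R_eps.
- move=> q x y x' y' [m h1] [n h2]; exists (maxn m n).
  by apply: R_lin => //; apply: mono; [|exact: h1| |exact: h2]; rewrite ?leq_maxl ?leq_maxr.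
- move=> x y x' y' [n h] h1 h2; exists n; exact: (R_sim (pos_ n)) h h1 h2.
- by move=> x y [n h]; apply: (R_pos (pos_ n)).
- by move=> x y [n h]; apply: (R_gam (pos_ n)).
- move=> x y [n h] nz; have [c [c' [h1 h2 h3 h4 h5]]] := R_val (pos_ n) h nz.
  by exists c, c'; split=> //; exists n.
- move=> c c' d d' [m h1] [n h2]; apply: (R_typ (pos_ (maxn m n))).
    by apply: mono h1; rewrite leq_maxl.
  by apply: mono h2; rewrite leq_maxr.
- have /choice[f hf] := fun n => R_cnt (pos_ n).
  apply: (@cnt_of _ E (nat * nat)%type (0%N, 0%N) _ (fun t => f t.1 t.2)).
    by move=> [m n] /=; exists m; have [h _] := hf m; apply: h.
  move=> x y [m h]; have [_ h'] := hf m; have [n [h1 h2]] := h' _ _ h.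
  by exists (m, n).
Qed.

(** The values of non-null elements are represented by related marks, whose comparison is [R_typ]
    with k = 0. *)
Lemma R_dom R x y x' y' : position R -> R x y -> R x' y' -> dom x x' <-> dom y y'.
Proof.
move=> pR h h'.
have [z|z] := pselect (null x').
  have z' : null y' by rewrite -(R_null pR h').
  split=> g; apply: (null_dom ax); first by rewrite -(R_null pR h); apply: (dom_null ax) z g.
  by rewrite (R_null pR h); apply: (dom_null ax) z' g.
have [z1|z1] := pselect (null x).
  have z1' : null y by rewrite -(R_null pR h).
  by split=> _; apply: (null_dom ax).
have [c [c' [Rc Wc Wc' [x1 x2] [y1 y2]]]] := R_val pR h' z.
have [d [d' [Rd Wd Wd' [x3 x4] [y3 y4]]]] := R_val pR h z1.
have T := R_typ pR Rc Rd Wc Wc' Wd Wd' 0%N; rewrite /= in T.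
have tr := dom_trans ax.
split=> g.
  by apply: (tr _ _ _ y3); apply: (tr _ c'); [apply/T; apply: (tr _ _ _ x4); apply: (tr _ _ _ g)|].
by apply: (tr _ _ _ x3); apply: (tr _ c); [apply/T; apply: (tr _ _ _ y4); apply: (tr _ _ _ g)|].
Qed.

Lemma R_eqval R x y x' y' : position R -> R x y -> R x' y' -> x =~ x' <-> y =~ y'.
Proof.
by move=> pR h h'; rewrite /eqval (R_dom pR h h') (R_dom pR h' h).
Qed.

Definition fits a b u v c' :=
  [/\ pos (a - u) -> pos (b - v), pos (u - a) -> pos (v - b) & b - v =~ c'].

(** The perturbation b1 - b is negligible against b - v, which has the value of c', so it alters
    neither its sign nor its value. *)
Lemma fits_small a b b1 u v c' : ~ dom c' (b1 - b) -> fits a b u v c' -> fits a b1 u v c'.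
Proof.
move=> h [h1 h2 h3].
have e : b1 - v = (b1 - b) + (b - v) by rewrite subrKA.
have e' : v - b1 = - (b1 - b) + (v - b) by rewrite opprB [RHS]addrC subrKA.
have n : ~ dom (b - v) (b1 - b) by move=> g; apply: h; case: h3 => _ h3; apply: (dom_trans ax) h3 g.
split=> [/h1 p|/h2 p|]; first by rewrite e; apply/(small_pos ax).
  rewrite e'; apply/(small_pos ax) => // /(domNr ax); rewrite opprK -opprB.
  by move=> /(domN ax); rewrite opprK.
by rewrite e; apply: (eqval_trans ax) (h3); apply: (small_eqval ax).
Qed.

(** Among the [(f n).1] closest to a in value, lo and hi are the nearest ones below and above. If
    one side is empty, it is replaced by a translate of the other by the mark, so that the width
    always has exactly that value. Both sides cannot be empty, since [(f c0).1] is on one of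
    them. *)
Lemma between R a (f c : nat -> V * V) (N c0 : nat) : position R ->
  (forall n, R (f n).1 (f n).2) -> (forall n, R (c n).1 (c n).2) ->
  (forall n, W (c n).1) ->
  (forall n, a - (f n).1 =~ (c n).1) ->
  (c0 <= N)%N ->
  (forall n, (n <= N)%N -> dom (a - (f c0).1) (a - (f n).1)) ->
  exists lo lo' hi hi', [/\ R lo lo', R hi hi', pos (hi - lo), hi - lo =~ (c c0).1 &
    forall n, (n <= N)%N -> dom (a - (f n).1) (c c0).1 ->
      [/\ dom (lo - (f n).1) (c c0).1,
        pos (a - (f n).1) -> ~ pos ((f n).1 - lo) &
        pos ((f n).1 - a) -> ~ pos (hi - (f n).1)]].
Proof.
move=> pR Rf Rc Wc fc c0N cmin; set cc := (c c0).1.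
have below n : (n <= N)%N -> dom cc (a - (f n).1).
  by move=> nN; have [_ h] := fc c0; apply: (dom_trans ax) h (cmin _ nN).
pose L n := dom (a - (f n).1) cc /\ pos (a - (f n).1).
pose U n := dom (a - (f n).1) cc /\ pos ((f n).1 - a).
have letr x y z : ~ pos (y - x) -> ~ pos (z - y) -> ~ pos (z - x).
  move=> h1 h2 h3; apply: (nonneg_add ax (x := x - y) (y := y - z)); rewrite ?opprB //.
  by rewrite subrKA opprB.
have letot x y : ~ pos (y - x) \/ ~ pos (x - y).
  have [h|h] := pselect (pos (y - x)); [right|by left].
  by rewrite -opprB; apply: (pos_asym ax).
have nn n m : dom (a - (f n).1) cc -> dom (a - (f m).1) cc -> dom ((f n).1 - (f m).1) cc.
  move=> h1 h2; have := domB ax h2 h1.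
  by rewrite (opprB a) addrC subrKA.
have low : (exists2 n, (n <= N)%N & L n) -> exists l, [/\ (l <= N)%N, L l &
    forall n, (n <= N)%N -> L n -> ~ pos ((f n).1 - (f l).1)].
  apply: argmax => [m n|l m n]; [exact: letot|exact: letr].
have upp : (exists2 n, (n <= N)%N & U n) -> exists l, [/\ (l <= N)%N, U l &
    forall n, (n <= N)%N -> U n -> ~ pos ((f l).1 - (f n).1)].
  apply: (@argmax U (fun l n => ~ pos ((f l).1 - (f n).1))) => [m n|l m n h1 h2].
    exact: letot.
  exact: letr h2 h1.
have Wcc : pos cc := mark_pos ax (Wc c0).
case: (pselect (exists2 n, (n <= N)%N & L n)) => [/low[l [lN [l1 l2] l3]]|nL];
  case: (pselect (exists2 n, (n <= N)%N & U n)) => [/upp[h [hN [h1 h2] h3]]|nU].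
- exists (f l).1, (f l).2, (f h).1, (f h).2.
  have e : (f h).1 - (f l).1 = ((f h).1 - a) + (a - (f l).1) by rewrite subrKA.
  have p : pos ((f h).1 - (f l).1) by rewrite e; apply: (posD ax).
  split=> // [|n nN nc].
    split; first exact: nn.
    apply: (dom_trans ax) (below _ lN) _; apply: (dom_convex ax).
      exact: (pos_asym ax).
    by rewrite e opprD addrCA addrN addr0; apply: (pos_asym ax).
  by split=> [|p1|p1]; [exact: nn|apply: l3|apply: h3].
- exists (f l).1, (f l).2, (cc + (f l).1), ((c c0).2 + (f l).2).
  rewrite addrK; split=> //; [exact: (R_add pR (Rc c0) (Rf l))|exact: (eqval_refl ax)|].
  move=> n nN nc; split=> [|p1|p1]; [exact: nn|exact: l3|].
  by case: nU; exists n.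
- exists ((f h).1 - cc), ((f h).2 - (c c0).2), (f h).1, (f h).2.
  have e : (f h).1 - ((f h).1 - cc) = cc by rewrite opprB addrC subrK.
  rewrite e; split=> //; [exact: (R_sub pR (Rf h) (Rc c0))|exact: (eqval_refl ax)|].
  move=> n nN nc; split=> [|p1|p1]; last exact: h3.
    by rewrite addrAC; apply: (domB ax); [|exact: (dom_refl ax)]; apply: nn.
  by case: nL; exists n.
- have near0 : dom (a - (f c0).1) cc by case: (fc c0).
  have [h|h|h] := sign_cases E (a - (f c0).1).
  + by case: nL; exists c0.
  + by case: (mark_nz ax (Wc c0)); apply: (null_eqval ax) (fc c0) h.
  + by rewrite opprB in h; case: nU; exists c0.
Qed.

(* Among the a - u_n choose one of largest value c. Those of smaller value are
   controlled by the isomorphism; for those of the same value, the midpoint of the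
   images of the nearest u_n below and above a works. The result is then moved
   into the group by an amount negligible with respect to c. *)
Lemma fill_finite R a (f c : nat -> V * V) (N : nat) : position R ->
  (forall n, R (f n).1 (f n).2) -> (forall n, R (c n).1 (c n).2) ->
  (forall n, W (c n).1) ->
  (forall n, a - (f n).1 =~ (c n).1) ->
  exists b, gam b /\ forall n, (n <= N)%N -> fits a b (f n).1 (f n).2 (c n).2.
Proof.
move=> pR Rf Rc Wc fc.
have [|||c0 [c0N _ cm]] := @argmax (fun=> True)
    (fun m n => dom (a - (f m).1) (a - (f n).1)) N.
- by move=> m n; apply: (dom_total ax).
- by move=> l m n; apply: (dom_trans ax).
- by exists 0%N.
have cmin n : (n <= N)%N -> dom (a - (f c0).1) (a - (f n).1) by move=> nN; apply: cm.
have [lo [lo' [hi [hi' [Rlo Rhi hl hlc H]]]]] := between pR Rf Rc Wc fc c0N cmin.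
pose b0 := (1 / 2%:R) *: (lo' + hi').
pose h := (1 / 2%:R) *: (hi' - lo').
have half : (1 / 2%:R : rat) != 0 by [].
have half2 x : x = (1 / 2%:R) *: x + (1 / 2%:R) *: x.
  by rewrite -scalerDl (_ : _ + _ = 1) ?scale1r //.
have blo : b0 = h + lo'.
  rewrite (half2 lo') /h /b0 -!scalerDr; congr (_ *: _).
  by rewrite addrA subrK addrC.
have bhi : hi' - b0 = h.
  rewrite (half2 hi') /h /b0 -!scalerDr -scalerBr; congr (_ *: _).
  by rewrite opprD addrACA subrr addr0.
have ph : pos h.
  rewrite /h pos_scaleE //; exact/(R_pos pR (R_sub pR Rhi Rlo)).
have hc : h =~ (c c0).2.
  apply: (eqval_trans ax) (eqvalZ ax _ half) _.
  exact/(R_eqval pR (R_sub pR Rhi Rlo) (Rc c0)).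
have Wc' : W (c c0).2 := R_mark ax pR (Rc c0) (Wc c0).
have key n : (n <= N)%N -> fits a b0 (f n).1 (f n).2 (c n).2.
  move=> nN; have [near|far] := pselect (dom (a - (f n).1) (c c0).1).
    have [g1 g2 g3] := H _ nN near.
    have Rl := R_sub pR Rlo (Rf n).
    have g1' : dom (lo' - (f n).2) (c c0).2 by rewrite -(R_dom pR Rl (Rc c0)).
    have g4 : dom (b0 - (f n).2) (c c0).2.
      by rewrite blo -addrA; apply: (dom_add ax) => //; case: hc.
    have same : (c c0).2 =~ (c n).2.
      rewrite -(R_eqval pR (Rc c0) (Rc n)); apply: (eqval_trans ax) (fc n); split=> //.
      by have [_ k] := fc c0; apply: (dom_trans ax) k (cmin _ nN).
    have up : dom h (b0 - (f n).2) -> b0 - (f n).2 =~ (c n).2.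
      move=> k; apply: (eqval_trans ax) (same); split=> //.
      by have [_ k'] := hc; apply: (dom_trans ax) k' k.
    have [p|p|p] := sign_cases E (a - (f n).1).
    + have nl : ~ pos (- (lo' - (f n).2)).
        rewrite opprB -(R_pos pR (R_sub pR (Rf n) Rlo)); exact: g2.
      split=> [_|q|]; first by rewrite blo -addrA; apply: (pos_addl ax).
        by case: (pos_asym ax p); rewrite opprB.
      apply: up; apply: (dom_convex ax); first exact: (pos_asym ax).
      by rewrite blo -addrA opprD addrA addrN add0r.
    + by case: (mark_nz ax (Wc n)); apply: (null_eqval ax) (fc n) p.
    + rewrite opprB in p.
      have nl : ~ pos (- ((f n).2 - hi')).
        rewrite opprB -(R_pos pR (R_sub pR Rhi (Rf n))); exact: g3.
      have e : (f n).2 - b0 = h + ((f n).2 - hi') by rewrite -bhi [RHS]addrC subrKA.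
      have p' : pos ((f n).2 - b0) by rewrite e; apply: (pos_addl ax).
      split=> // [q|]; first by case: (pos_asym ax p); rewrite opprB.
      apply: up; rewrite -opprB; apply: (domNr ax).
      apply: (dom_convex ax); first exact: (pos_asym ax).
      by rewrite e opprD addrA addrN add0r.
  (* Here a is much closer to [(f c0).1] than to [(f n).1], so [(f c0).2] itself fits; passing from
     it to b0 is a negligible change. *)
  have Re := R_sub pR (Rf c0) (Rf n).
  have small : ~ dom (a - (f n).1) (a - (f c0).1).
    by move=> k; apply: far; apply: (dom_trans ax) k _; case: (fc c0).
  have e : (f c0).1 - (f n).1 = - (a - (f c0).1) + (a - (f n).1).
    by rewrite opprB subrKA.
  have eo : (f n).1 - (f c0).1 = (a - (f c0).1) + ((f n).1 - a).
    by rewrite [RHS]addrC subrKA.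
  have small' : ~ dom (a - (f n).1) (- (a - (f c0).1)).
    by move=> /(domNr ax); rewrite opprK.
  have small'' : ~ dom ((f n).1 - a) (a - (f c0).1).
    by rewrite -opprB => /(domN ax); rewrite opprK.
  have as1 : (f c0).1 - (f n).1 =~ (c n).1.
    by rewrite e; apply: (eqval_trans ax) (small_eqval ax small') (fc n).
  have as2 : (f c0).2 - (f n).2 =~ (c n).2 by rewrite -(R_eqval pR Re (Rc n)).
  apply: (@fits_small a (f c0).2) => //; last first.
    split=> // p.
      by rewrite -(R_pos pR Re) e small_pos.
    by rewrite -(R_pos pR (R_sub pR (Rf n) (Rf c0))) eo small_pos.
  have [near0 _] := fc c0.
  have [] := H _ c0N near0; rewrite (R_dom pR (R_sub pR Rlo (Rf c0)) (Rc c0)) => k _ _.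
  have k1 : dom (b0 - (f c0).2) (c c0).2.
    by rewrite blo -addrA; apply: (dom_add ax) => //; case: hc.
  move=> k2; apply: far; have [k3 _] := fc n; apply: (dom_trans ax) k3 _.
  by rewrite (R_dom pR (Rc n) (Rc c0)); apply: (dom_trans ax) k2 k1.
have [b gb sb] := gam_dense ax b0 Wc'.
exists b; split=> // n nN; apply: (@fits_small a b0); last exact: key.
move=> k; apply: sb; rewrite -opprB; apply: (domNr ax); apply: (dom_trans ax) k.
rewrite -(R_dom pR (Rc c0) (Rc n)).
have [_ k1] := fc c0; apply: (dom_trans ax) k1 _; apply: (dom_trans ax) (cmin _ nN) _.
by case: (fc n).
Qed.

(** After closing, every difference a - u has its value among the marks already present, so adding a
    creates no mark. The answer b has to satisfy countably many conditions on sign and value,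
    finitely many of which are met by [fill_finite]. *)
Lemma forth R a : position R -> gam a ->
  exists R' b, [/\ position R', (forall x y, R x y -> R' x y), R' a b & gam b].
Proof.
move=> pR ga; have [Q [pQ RQ cl]] := close_chain a pR.
case: (pselect (exists u v, Q u v /\ null (a - u))) => [[u [v [Quv z]]]|no].
  have Qa : Q a v by apply: (R_sim pQ) Quv (sim_sym z) (sim_refl ax _).
  by exists Q, v; split=> //; rewrite -(R_gam pQ Qa).
have nz u v : Q u v -> ~ null (a - u) by move=> h z; apply: no; exists u, v.
have [f [f1 f2]] := R_cnt pQ.
have /choice[c hc] : forall n, exists cc : V * V,
    [/\ Q cc.1 cc.2, W cc.1 & a - (f n).1 =~ cc.1].
  by move=> n; have [d [d' [h1 h2 h3]]] := cl _ _ (f1 n) (nz _ _ (f1 n)); exists (d, d').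
have c1 n : Q (c n).1 (c n).2 by case: (hc n).
have c2 n : W (c n).1 by case: (hc n).
have c3 n : a - (f n).1 =~ (c n).1 by case: (hc n).
pose P n b := gam b /\ ((pos (a - (f n).1) -> pos (b - (f n).2)) /\
  ((pos ((f n).1 - a) -> pos ((f n).2 - b)) /\
   (dom (b - (f n).2) (c n).2 /\ dom (c n).2 (b - (f n).2)))).
have [|N|b hb] := @saturation _ _ _ sat P.
- move=> n; apply: (I_and sat); first exact: I_gam.
  apply: (I_and sat); first by apply: (I_imp sat); apply: I_posl.
  apply: (I_and sat); first by apply: (I_imp sat); apply: I_posr.
  by apply: (I_and sat); [apply: I_doml|apply: I_domr].
- have [b [gb hb]] := fill_finite N pQ f1 c1 c2 c3.
  by exists b => n /hb[? ? [? ?]].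
have gb : gam b by case: (hb 0%N).
have fit u v : Q u v -> exists c c',
    [/\ Q c c', W c & fits a b u v c' /\ a - u =~ c].
  move=> /f2[n [un vn]]; exists (c n).1, (c n).2; split=> //.
  have [_ [h1 [h2 h3]]] := hb n.
  have e1 := simB ax (sim_refl ax a) un; have e2 := simB ax un (sim_refl ax a).
  have e3 := simB ax (sim_refl ax b) vn; have e4 := simB ax vn (sim_refl ax b).
  split; last exact: (eqval_trans ax) (sim_eqval ax e1) (c3 n).
  split; last exact: (eqval_trans ax) (sim_eqval ax e3) h3.
    by rewrite (pos_simE ax e1) (pos_simE ax e3).
  by rewrite (pos_simE ax e2) (pos_simE ax e4).
exists (ext Q a b), b; split=> //; last exact: (mem_ext ax);
  last by move=> x y /RQ; apply: (sub_ext ax).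
apply: (ext_position ax (T := fun c c' => Q c c' /\ W c) pQ).
- move=> u v Quv; have [d [d' [Qd Wd [[h1 h2 _] _]]]] := fit _ _ Quv.
  split; split=> // p.
    have [//|k|k] := sign_cases E (a - u); first by case: (nz _ _ Quv).
    by move: k; rewrite opprB => /h2 /(pos_asym ax); rewrite opprB.
  have [//|k|k] := sign_cases E (u - a); first by case: (nz _ _ Quv); rewrite -opprB; apply: nullN.
  by move: k; rewrite opprB => /h1 /(pos_asym ax); rewrite opprB.
- by exists 0, 0; rewrite !subr0; split=> //; apply: R_0 pQ.
- move=> d d' [h1 h2]; split=> //; first exact: (R_mark ax pQ h1).
  exact: (sub_ext ax).
- move=> u v h nzu; have [d [d' [h1 h2 h3 h4 h5]]] := R_val pQ h nzu.
  by exists d, d'.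
- move=> u v h _; have [d [d' [h1 h2 [[_ _ h3] h4]]]] := fit _ _ h.
  by exists d, d'.
- move=> d d' e e' [h1 h2] [h3 h4] k.
  by apply: (R_typ pQ) => //; [apply: (R_mark ax pQ h1)|apply: (R_mark ax pQ h3)].
Qed.
End Forth.

(** * Ultrapowers *)

Record free_ultrafilter (U : (nat -> Prop) -> Prop) : Prop := {
  U_mono : forall P Q : nat -> Prop, (forall n, P n -> Q n) -> U P -> U Q;
  U_and : forall P Q : nat -> Prop, U P -> U Q -> U (fun n => P n /\ Q n);
  U_dec : forall P : nat -> Prop, U P \/ U (fun n => ~ P n);
  U_False : ~ U (fun=> False);
  U_tail : forall N, U (fun n => (N <= n)%N)
}.

Lemma exists_free_ultrafilter : exists U, free_ultrafilter U.
Proof.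
have [U [uU sub]] := @ultraFilterLemma nat eventually _.
exists U; split.
- by move=> P Q PQ; apply: filterS.
- by move=> P Q; apply: filterI.
- by move=> P; apply: in_ultra_setVsetC.
- exact: filter_not_empty.
- by move=> N; apply: sub; exists N.
Qed.

Section Ultra.
Variables (U : (nat -> Prop) -> Prop) (fU : free_ultrafilter U).

Lemma U_all (P : nat -> Prop) : (forall n, P n) -> U P.
Proof. by move=> h; apply: (U_mono fU) (U_tail fU 0). Qed.

Lemma U_mono2 (P Q T : nat -> Prop) :
  (forall n, P n -> Q n -> T n) -> U P -> U Q -> U T.
Proof. by move=> h h1 h2; apply: (U_mono fU) (U_and fU h1 h2) => n []; apply: h. Qed.

Lemma U_mono3 (P Q T X : nat -> Prop) :
  (forall n, P n -> Q n -> T n -> X n) -> U P -> U Q -> U T -> U X.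
Proof.
by move=> h h1 h2; apply: U_mono2 (U_and fU h1 h2) => n []; apply: h.
Qed.

Lemma U_not (P : nat -> Prop) : U (fun n => ~ P n) <-> ~ U P.
Proof.
split=> h; last by case: (U_dec fU P).
by move=> h'; apply: (U_False fU); apply: U_mono2 h' h => n p; apply.
Qed.

Lemma U_iff (P Q : nat -> Prop) : U (fun n => P n <-> Q n) -> U P <-> U Q.
Proof. by move=> h; split; apply: U_mono2 h => n []. Qed.

Lemma U_andE (P Q : nat -> Prop) : U (fun n => P n /\ Q n) <-> U P /\ U Q.
Proof.
split=> [h|[]]; last exact: (U_and fU).
by split; apply: (U_mono fU) h => n [].
Qed.

Lemma U_orE (P Q : nat -> Prop) : U (fun n => P n \/ Q n) <-> U P \/ U Q.
Proof.
split=> [h|[]]; [|by apply: (U_mono fU) => n; left|by apply: (U_mono fU) => n; right].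
have [?|hP] := U_dec fU P; first by left.
by right; apply: U_mono2 h hP => n [].
Qed.

Lemma U_impE (P Q : nat -> Prop) : U (fun n => P n -> Q n) <-> (U P -> U Q).
Proof.
split=> [h h'|h]; first by apply: U_mono2 h h' => n; apply.
have [/h|hP] := U_dec fU P; first by apply: (U_mono fU).
by apply: (U_mono fU) hP => n np /np.
Qed.

Lemma U_const (P : Prop) : U (fun=> P) <-> P.
Proof.
split=> h; last exact: U_all.
by apply: contrapT => np; apply: (U_False fU); apply: (U_mono fU) h.
Qed.

Lemma U_ex (T : Type) (P : nat -> T -> Prop) (t0 : T) :
  U (fun n => exists t, P n t) <-> exists f : nat -> T, U (fun n => P n (f n)).
Proof.
split=> [h|[f h]]; last by apply: (U_mono fU) h => n ?; exists (f n).
have /choice[f hf] : forall n, exists t, (exists t', P n t') -> P n t.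
  move=> n; case: (pselect (exists t', P n t')) => [[t pt]|no]; first by exists t.
  by exists t0 => /no.
by exists f; apply: (U_mono fU) h => n; apply: hf.
Qed.

Variables (H : lmodType rat) (E : valued_data H) (ax : valued_laws E).

Definition ultra_data : valued_data (nat -> H) := {|
  pos x := U (fun n => pos E (x n));
  dom x y := U (fun n => dom E (x n) (y n));
  mark x := U (fun n => mark E (x n));
  nxt x := fun n => nxt E (x n);
  eps := fun=> eps E;
  gam x := U (fun n => gam E (x n)) |}.

Local Notation E' := ultra_data.

Lemma ultra_null x : null E' x <-> U (fun n => null E (x n)).
Proof. by rewrite /null /= -!U_not -U_andE. Qed.

Lemma ultra_sim x y : sim E' x y <-> U (fun n => sim E (x n) (y n)).
Proof. exact: ultra_null. Qed.

Lemma ultra_eqval x y : eqval E' x y <-> U (fun n => eqval E (x n) (y n)).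
Proof. by rewrite /eqval /= -U_andE. Qed.

Lemma ultra_laws : valued_laws E'.
Proof.
split.
- by move=> x h; rewrite -U_not; apply: (U_mono fU) h => n; apply: (pos_asym ax).
- move=> x y; rewrite -!U_not; apply: U_mono2 => n; exact: (nonneg_add ax).
- by move=> q x q0; apply: (U_mono fU) => n; apply: (pos_scale ax).
- by move=> x y /=; rewrite -U_orE; apply: U_all => n; apply: (dom_total ax).
- by move=> x y z; apply: U_mono2 => n; apply: (dom_trans ax).
- by move=> x y z; apply: U_mono2 => n; apply: (dom_add ax).
- by move=> q x; apply: U_all => n; apply: (dom_scale ax).
- by move=> x y; rewrite -!U_not; apply: U_mono2 => n; apply: (dom_convex ax).
- by move=> x y; rewrite !ultra_null; apply: U_mono2 => n; apply: (dom_null ax).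
- by move=> c; apply: (U_mono fU) => n; apply: (mark_pos ax).
- by move=> c d h1 h2; rewrite ultra_eqval ultra_sim; apply: U_mono3 h1 h2 => n; apply: (mark_eq ax).
- by move=> c d h1; rewrite ultra_sim; apply: U_mono2 h1 => n; apply: (mark_sim ax).
- move=> x; rewrite ultra_null -U_not => h.
  have : U (fun n => exists c, mark E c /\ eqval E (x n) c).
    by apply: (U_mono fU) h => n /(mark_val ax)[c]; exists c.
  by move=> /(U_ex _ 0)[c /U_andE[h1 h2]]; exists c => //; rewrite ultra_eqval.
- by move=> c; apply: (U_mono fU) => n; apply: (nxt_mark ax).
- move=> c d h1 h2 /=; rewrite -U_not; apply: U_iff.
  by apply: U_mono2 h1 h2 => n; apply: (nxt_lt ax).
- by apply: U_all => n; apply: (eps_mark ax).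
- by move=> c; apply: (U_mono fU) => n; apply: (eps_max ax).
- move=> c h; rewrite ultra_sim.
  have : U (fun n => sim E (c n) (eps E) \/ exists d, mark E d /\ sim E (c n) (nxt E d)).
    by apply: (U_mono fU) h => n /(nxt_pred ax)[?|[d ? ?]]; [left|right; exists d].
  move=> /U_orE[?|/(U_ex _ 0)[d /U_andE[h1 h2]]]; [by left|right].
  by exists d => //; rewrite ultra_sim.
- by move=> q x y; apply: U_mono2 => n; apply: (gam_lin ax).
- by move=> x y; rewrite ultra_sim; apply: U_mono2 => n; apply: (gam_sim ax).
- by move=> c; apply: (U_mono fU) => n; apply: (gam_eps ax).
- move=> x c h.
  have : U (fun n => exists y, gam E y /\ ~ dom E (c n) (x n - y)).
    by apply: (U_mono fU) h => n /(gam_dense ax (x n))[y]; exists y.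
  by move=> /(U_ex _ 0)[y /U_andE[h1 h2]]; exists y => //=; rewrite -U_not.
Qed.

Definition internal (P : (nat -> H) -> Prop) :=
  exists P0 : nat -> H -> Prop, forall x, P x <-> U (fun n => P0 n (x n)).

Lemma ultra_iter k (x : nat -> H) n : iter k (nxt E') x n = iter k (nxt E) (x n).
Proof. by elim: k => //= k ->. Qed.

(** For saturation, coordinate n satisfies the longest satisfiable initial segment of the conditions
    of index at most n. As U contains all tails, condition k is among those considered at almost
    every n. *)
Lemma ultra_saturated : saturated E' internal.
Proof.
split.
- move=> A P [P0 h]; exists (fun n b => A -> P0 n b) => x.
  by rewrite U_impE U_const h.
- move=> P Q [P0 hP] [Q0 hQ]; exists (fun n b => P0 n b /\ Q0 n b) => x.
  by rewrite U_andE hP hQ.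
- by move=> v; exists (fun n b => pos E (b - v n)).
- by move=> v; exists (fun n b => pos E (v n - b)).
- by move=> v c; exists (fun n b => dom E (b - v n) (c n)).
- by move=> v c; exists (fun n b => dom E (c n) (b - v n)).
- by exists (fun=> mark E).
- by exists (fun=> gam E).
- move=> k c; exists (fun n b => dom E b (iter k (nxt E) (c n))) => x /=.
  by apply: U_iff; apply: U_all => n; rewrite ultra_iter.
- move=> k c; exists (fun n b => dom E (c n) (iter k (nxt E) b)) => x /=.
  by apply: U_iff; apply: U_all => n; rewrite ultra_iter.
- move=> P /choice[P0 hP] fin.
  have /choice[b hb] : forall n, exists b, forall k, (k <= n)%N ->
      (exists b', forall i, (i <= k)%N -> P0 i n b') -> P0 k n b.
    (* Only the bound on k is generalised; the coordinate n stays fixed. *)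
    move=> n; move: {1}n => M; elim: M => [|m [b IH]].
      case: (pselect (exists b, P0 0%N n b)) => [[b hb]|no].
        by exists b => k; rewrite leqn0 => /eqP ->.
      by exists 0 => k; rewrite leqn0 => /eqP -> [b' /(_ 0%N isT) ?]; case: no; exists b'.
    case: (pselect (exists b', forall i, (i <= m.+1)%N -> P0 i n b')) => [[b' hb']|no].
      by exists b' => k km _; apply: hb'.
    by exists b => k; rewrite leq_eqVlt => /orP[/eqP -> /no //|]; apply: IH.
  exists b => k; rewrite hP.
  have [b' hb'] := fin k.
  have h : U (fun n => forall i, (i <= k)%N -> P0 i n (b' n)).
    elim: k hb' => [|k IH] hb'.
      have /hP := hb' 0%N isT; apply: (U_mono fU) => n h i.
      by rewrite leqn0 => /eqP ->.
    have /hP h1 := hb' k.+1 (leqnn _).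
    have h2 := IH (fun i ik => hb' i (leqW ik)).
    by apply: U_mono2 h1 h2 => n g1 g2 i; rewrite leq_eqVlt => /orP[/eqP ->|/g2].
  apply: U_mono2 h (U_tail fU k) => n h1 kn; apply: (hb n k kn).
  by exists (b' n).
Qed.

End Ultra.

(** * The valued space of an asymptotic couple *)

Section OrderedGroup.
Variables (G : porderZmodType) (hG : ordered_abelian_group G).
Implicit Types x y z : G.

Lemma oag_subr_ge0 x y : (0 <= y - x) = (x <= y).
Proof.
apply/idP/idP => [/(oag_leD2r hG x)|/(oag_leD2r hG (- x))].
  by rewrite add0r subrK.
by rewrite subrr.
Qed.

Lemma oag_subr_gt0 x y : (0 < y - x) = (x < y).
Proof. by rewrite !lt_neqAle oag_subr_ge0 eq_sym subr_eq0 eq_sym. Qed.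

Lemma oag_oppr_ge0 x : (0 <= - x) = (x <= 0).
Proof. by rewrite -oag_subr_ge0 sub0r. Qed.

Lemma oag_oppr_gt0 x : (0 < - x) = (x < 0).
Proof. by rewrite -oag_subr_gt0 sub0r. Qed.

Lemma oag_addr_ge0 x y : 0 <= x -> 0 <= y -> 0 <= x + y.
Proof. by move=> x0 /(oag_leD2r hG x); rewrite add0r addrC; apply: le_trans. Qed.

Lemma oag_addr_gt0 x y : 0 < x -> 0 <= y -> 0 < x + y.
Proof.
move=> x0 /(oag_leD2r hG x); rewrite add0r addrC; exact: lt_le_trans.
Qed.

Lemma oag_ltNge x y : (x < y) = ~~ (y <= x).
Proof.
have h : (x >=< y)%O by rewrite /Order.comparable; case/orP: (oag_total hG x y) => ->; rewrite ?orbT.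
exact: comparable_ltNge.
Qed.

Lemma oag_leNgt x y : (x <= y) = ~~ (y < x).
Proof. by rewrite oag_ltNge negbK. Qed.

Lemma oag_mulrn_gt0 x n : 0 < x -> 0 < x *+ n.+1.
Proof.
move=> x0; elim: n => // n IH; rewrite mulrS; apply: oag_addr_gt0 => //; exact: ltW.
Qed.

Lemma oag_gt0_or_lt0 x : x != 0 -> 0 < x \/ x < 0.
Proof.
move=> x0; case/orP: (oag_total hG x 0) => h; [right|left]; rewrite lt_neqAle h andbT //.
by rewrite eq_sym.
Qed.

Lemma oag_mulrz_gt0 x (n : int) : 0 < x -> 0 < n -> 0 < x *~ n.
Proof. by case: n => // -[|n] // x0 _; apply: oag_mulrn_gt0. Qed.

Lemma oag_torsion_free x y (n : int) : n != 0 -> x *~ n = y *~ n -> x = y.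
Proof.
move=> n0 /eqP; rewrite -subr_eq0 -mulrzBl => /eqP h; apply/eqP; rewrite -subr_eq0.
move: h; set z := x - y; apply: contra_eqT => z0.
have pp (w : G) (m : int) : 0 < w -> m != 0 -> w *~ m != 0.
  move=> w0 m0; have [mm|mm|mm] := ltgtP m 0; last by rewrite mm in m0.
    rewrite -[m]opprK mulrNz oppr_eq0 gt_eqF // oag_mulrz_gt0 //.
    by rewrite oppr_gt0.
  by rewrite gt_eqF // oag_mulrz_gt0.
case: (oag_gt0_or_lt0 z0) => h; first exact: pp.
by rewrite -[z]opprK mulNrz oppr_eq0; apply: pp => //; rewrite oag_oppr_gt0.
Qed.

End OrderedGroup.

(** * Scaling by rationals in a divisible torsion-free group *)

Section RationalScaling.
Variables (G : zmodType) (delta : nat -> G -> G).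
Hypothesis deltaK : forall n a, delta n a *+ n.+1 = a.
Hypothesis torsion_free : forall (x y : G) (n : int), n != 0 -> x *~ n = y *~ n -> x = y.

(** The predecessor compensates the shift in [delta], whose index n means division by n + 1. *)
Definition qscale (q : rat) (g : G) : G := delta `|denq q|.-1 (g *~ numq q).

Lemma qscale_den q g : qscale q g *~ denq q = g *~ numq q.
Proof.
rewrite -{1}(deltaK `|denq q|.-1 (g *~ numq q)) -/(qscale q g).
have : 0 < denq q by [].
by case: (denq q) => // -[].
Qed.

(** Torsion-freeness allows any fraction m / n equal to q, reduced or not; the module laws become
    identities between fractions. *)
Lemma qscaleP q g y (n m : int) : n != 0 -> q * n%:~R = m%:~R -> y *~ n = g *~ m ->
  y = qscale q g.
Proof.
move=> n0 e h; apply: (@torsion_free _ _ (n * denq q)).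
  by rewrite mulf_neq0 // denq_neq0.
rewrite !mulrzA h [RHS]mulrzAC qscale_den -!mulrzA; congr (_ *~ _).
apply: (@intr_inj rat); rewrite !rmorphM /= -e mulrAC.
by rewrite -{1}[q]divq_num_den mulfVK // intr_eq0 denq_neq0.
Qed.

Lemma qscaleA a b g : qscale a (qscale b g) = qscale (a * b) g.
Proof.
apply: (@qscaleP _ _ _ (denq b * denq a) (numq b * numq a)).
- by rewrite mulf_neq0 // denq_neq0.
- rewrite !rmorphM /= -{1}[a]divq_num_den -{1}[b]divq_num_den.
  by field; rewrite !intr_eq0 !denq_neq0.
- by rewrite [denq b * _]mulrC !mulrzA qscale_den mulrzAC qscale_den -!mulrzA mulrC.
Qed.

Lemma qscale1 g : qscale 1 g = g.
Proof. by symmetry; apply: (@qscaleP _ _ _ 1 1). Qed.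

Lemma qscaleDr q g h : qscale q (g + h) = qscale q g + qscale q h.
Proof.
symmetry; apply: (@qscaleP _ _ _ (denq q) (numq q)); rewrite ?denq_neq0 //.
  by rewrite -{1}[q]divq_num_den mulfVK // intr_eq0 denq_neq0.
by rewrite !mulrzDl !qscale_den.
Qed.

Lemma qscaleDl g a b : qscale (a + b) g = qscale a g + qscale b g.
Proof.
symmetry; apply: (@qscaleP _ _ _ (denq a * denq b) (numq a * denq b + numq b * denq a)).
- by rewrite mulf_neq0 // denq_neq0.
- rewrite !rmorphD !rmorphM /= -{1}[a]divq_num_den -{1}[b]divq_num_den.
  by field; rewrite !intr_eq0 !denq_neq0.
- rewrite mulrzDl mulrzA qscale_den [denq a * _]mulrC mulrzA qscale_den.
  by rewrite -!mulrzA -mulrzDr.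
Qed.

End RationalScaling.

(** * The space Gamma + Q eps *)

Section Base.
Variables (G : porderZmodType) (D : log_structure G) (hD : models_Tlog D).

(* A copy of [G] carrying the scaling by rationals that [ldelta D] provides. *)
Definition qspace (_ : models_Tlog D) : Type := G.

Let hT := Tlog_T0 hD.
Let hAC := T0_couple hT.
Let hG := ac_group hAC.

HB.instance Definition _ := GRing.Zmodule.copy (qspace hD) G.
HB.instance Definition _ := GRing.Zmodule_isLmodule.Build rat (qspace hD)
  (qscaleA (Tlog_delta hD) (oag_torsion_free hG))
  (qscale1 (Tlog_delta hD) (oag_torsion_free hG))
  (qscaleDr (Tlog_delta hD) (oag_torsion_free hG))
  (qscaleDl (Tlog_delta hD) (oag_torsion_free hG)).

(* [(g, q)] stands for g + q eps. *)
Definition hat : lmodType rat := (qspace hD * rat^o)%type.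


Local Notation psi := (lpsi D).
Local Notation s := (ls D).
Local Notation Psi := (Psi psi).

Implicit Types (a b g h e x y z : G).

Lemma psiN a : a != 0 -> psi (- a) = psi a.
Proof. by move=> a0; have := AC2 hAC (r := -1) isT a0. Qed.

Lemma psiD a b y : a != 0 -> b != 0 -> a + b != 0 -> y <= psi a -> y <= psi b ->
  y <= psi (a + b).
Proof.
move=> a0 b0 ab0 ya yb; apply: le_trans (AC1 hAC a0 b0 ab0).
by rewrite /Order.min; case: ifP.
Qed.

(** AC1 for a + b and - b shows that the value does not increase. A change of sign would trap a
    positive a below - b, against H-type. *)
Lemma psi_small a b : a != 0 -> b != 0 -> psi a < psi b ->
  [/\ a + b != 0, psi (a + b) = psi a & 0 < a + b <-> 0 < a].
Proof.
move=> a0 b0 ab.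
have ab0 : a + b != 0.
  by apply: contraTneq ab => /eqP; rewrite addr_eq0 => /eqP ->; rewrite psiN // ltxx.
have e : psi (a + b) = psi a.
  apply/eqP; rewrite eq_le; apply/andP; split; last by apply: psiD => //; apply: ltW.
  rewrite (oag_leNgt hG); apply/negP => h.
  suff : psi a < psi a by rewrite ltxx.
  have nb : - b != 0 by rewrite oppr_eq0.
  have := AC1 hAC ab0 nb; rewrite addrK psiN // => /(_ a0); apply: lt_le_trans.
  by rewrite /Order.min; case: ifP.
have pos (c d : G) : c != 0 -> d != 0 -> psi c < psi d -> c + d != 0 -> 0 < c -> 0 < c + d.
  move=> c0 d0 cd cd0 pc; case: (oag_gt0_or_lt0 hG cd0) => // neg.
  have dc : c <= - d by rewrite -(oag_subr_ge0 hG) -opprD addrC (oag_oppr_ge0 hG) ltW.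
  have := T0_H hT pc dc; rewrite psiN // => /(lt_le_trans cd); by rewrite ltxx.
split=> //; split=> h; last exact: pos.
case: (oag_gt0_or_lt0 hG a0) => // neg.
have na : - a != 0 by rewrite oppr_eq0.
have nb : - b != 0 by rewrite oppr_eq0.
have := pos (- a) (- b) na nb; rewrite !psiN // -opprD oppr_eq0 (oag_oppr_gt0 hG) => k.
by have := k ab ab0 neg; rewrite (oag_oppr_gt0 hG) => /(lt_trans h); rewrite ltxx.
Qed.

(** The element a - s a is the integral of a. *)
Lemma s_spec a : [/\ a - s a != 0, psi (a - s a) = s a & Psi (s a)].
Proof.
have [b b0 ba] := T0_int hT a; rewrite (T0_s hT b0 ba).
rewrite -ba /asymptotic_derivative addrK; split=> //; by exists b.
Qed.

Lemma s0_least x : Psi x -> s 0 <= x.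
Proof. by case: (T0_least hT) => _; apply. Qed.

Lemma Psi_gt0 x : Psi x -> 0 < x.
Proof. by move=> /s0_least; apply: lt_le_trans (T0_s0_gt0 hT). Qed.

(** With 0 as a predecessor of s0, the map s is an order isomorphism onto Psi and the least element
    needs no separate treatment. *)
Definition Psi0 (x : G) : Prop := x = 0 \/ Psi x.

Lemma Psi0_s x : Psi0 x -> immediate_successor Psi x (s x).
Proof.
case=> [->|]; last exact: T0_succ.
by split; [case: (T0_least hT)|exact: (T0_s0_gt0 hT)|move=> z /s0_least].
Qed.

Lemma Psi0_ge0 x : Psi0 x -> 0 <= x.
Proof. by case=> [->|/Psi_gt0/ltW]. Qed.

Lemma lt_Psi x y : Psi0 x -> Psi0 y -> x < y -> Psi y.
Proof. by move=> /Psi0_ge0 x0 [->|//] /(le_lt_trans x0); rewrite ltxx. Qed.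

Lemma s_lt x y : Psi0 x -> Psi0 y -> s x <= y <-> x < y.
Proof.
move=> hx hy; have [h1 h2 h3] := Psi0_s hx; split; first exact: lt_le_trans.
by move=> xy; apply: h3 => //; apply: lt_Psi xy.
Qed.

Lemma s_mono x y : Psi0 x -> Psi0 y -> s x <= s y <-> x <= y.
Proof.
move=> hx hy; have [h1 h2 _] := Psi0_s hy.
rewrite s_lt //; last by right.
split=> [|/le_lt_trans]; last by apply.
rewrite !(oag_leNgt hG) => h; apply/negP => h'.
have /(s_lt hy hx) := h'; by rewrite (oag_leNgt hG) h.
Qed.

Lemma Psi_pred y : Psi y -> exists2 x, Psi0 x & s x = y.
Proof.
move=> hy; have := s0_least hy; rewrite le_eqVlt => /orP[/eqP <-|h].
  by exists 0 => //; left.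
by have [x hx e] := T0_surj hT (conj hy h); exists x => //; right.
Qed.

(** H-type bounds the value from above by that of s x - x, the negative of the integral of x. From
    below, AC3 gives y < (y - x) + psi (y - x), so the value exceeds x and is at least s x. *)
Lemma psi_sub x y : Psi0 x -> Psi y -> x < y -> psi (y - x) = s x.
Proof.
move=> hx hy xy.
have [h1 h2 h3] := Psi0_s hx; have [k1 k2 _] := s_spec x.
have yx : 0 < y - x by rewrite (oag_subr_gt0 hG).
have sx : 0 < s x - x by rewrite (oag_subr_gt0 hG).
have yx0 : y - x != 0 by rewrite gt_eqF.
apply/eqP; rewrite eq_le; apply/andP; split.
  have e : psi (s x - x) = s x by rewrite -opprB psiN.
  rewrite -[X in _ <= X]e; apply: (T0_H hT) => //.
  by apply: (oag_leD2r hG); apply: h3.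
apply: h3; first by exists (y - x).
have [z z0 zy] := hy; have := AC3 hAC yx0 z0 yx; rewrite zy -(oag_subr_gt0 hG).
by rewrite addrAC (addrAC y) subrr add0r addrC (oag_subr_gt0 hG).
Qed.

(** The summands s b - b and e - s b have values s b and s (s b), so the first one dominates. The
    resulting value and sign do not depend on e, which is what permits a formal limit eps. *)
Lemma psi_tail b e : Psi e -> s b < e ->
  [/\ e - b != 0, psi (e - b) = s b & 0 < e - b <-> 0 < s b - b].
Proof.
move=> he be; have [k1 k2 k3] := s_spec b.
have sb : s b - b != 0 by rewrite -opprB oppr_eq0.
have pb : psi (s b - b) = s b by rewrite -opprB psiN.
have es : e - s b != 0 by rewrite gt_eqF // (oag_subr_gt0 hG).
have := psi_small sb es; rewrite pb (psi_sub (or_intror k3) he be).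
rewrite (_ : s b - b + (e - s b) = e - b); last by rewrite addrC subrKA.
by apply; have [_ ? _] := Psi0_s (or_intror k3).
Qed.


Definition qmul (q : rat) (a : G) : G := q *: (a : qspace hD).

Lemma qmul_den q a : qmul q a *~ denq q = a *~ numq q.
Proof. exact: (qscale_den (Tlog_delta hD)). Qed.

Lemma qmul_neq0 q a : q != 0 -> a != 0 -> qmul q a != 0.
Proof. by move=> q0 a0; rewrite /qmul (scaler_eq0 q (a : qspace hD)) negb_or q0. Qed.

Lemma psi_qmul q a : q != 0 -> a != 0 -> psi (qmul q a) = psi a.
Proof.
move=> q0 a0; rewrite -(AC2 hAC (denq_neq0 q) (qmul_neq0 q0 a0)) qmul_den.
by apply: AC2 => //; rewrite numq_eq0.
Qed.

Lemma qmul_gt0 (q : rat) a : 0 < q -> 0 < a -> 0 < qmul q a.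
Proof.
move=> q0 a0; have : qmul q a != 0 by apply: qmul_neq0; rewrite gt_eqF.
case/(oag_gt0_or_lt0 hG) => // h.
have : 0 < (- qmul q a) *~ denq q by apply: (oag_mulrz_gt0 hG) => //; rewrite (oag_oppr_gt0 hG).
have nq : 0 < numq q by rewrite numq_gt0.
rewrite mulNrz qmul_den (oag_oppr_gt0 hG) => /lt_trans /(_ (oag_mulrz_gt0 hG a0 nq)).
by rewrite ltxx.
Qed.

Definition near_top (P : G -> Prop) : Prop :=
  exists2 e0, Psi e0 & forall e, Psi e -> e0 <= e -> P e.

Lemma near_top_mono (P Q : G -> Prop) : (forall e, P e -> Q e) -> near_top P -> near_top Q.
Proof. by move=> h [e0 h0 h1]; exists e0 => // e he /(h1 _ he); apply: h. Qed.

Lemma near_top_mono2 (P Q T : G -> Prop) : (forall e, P e -> Q e -> T e) ->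
  near_top P -> near_top Q -> near_top T.
Proof.
move=> h [a ha ka] [b hb kb].
case/orP: (oag_total hG a b) => ab; [exists b|exists a] => // e he le; apply: h.
- by apply: ka => //; apply: le_trans le.
- exact: kb.
- exact: ka.
- by apply: kb => //; apply: le_trans le.
Qed.

Lemma near_top_mono3 (P Q T X : G -> Prop) : (forall e, P e -> Q e -> T e -> X e) ->
  near_top P -> near_top Q -> near_top T -> near_top X.
Proof.
move=> h h1 h2 h3; apply: (@near_top_mono2 (fun e => P e /\ Q e) T) => // [e []|].
  exact: h.
exact: near_top_mono2 h1 h2.
Qed.

Lemma near_top_ex (P : G -> Prop) : near_top P -> exists e, P e.
Proof. by case=> e0 h0 h1; exists e0; apply: h1. Qed.

Lemma near_top_all (P : G -> Prop) : (forall e, P e) -> near_top P.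
Proof. by move=> h; exists (s 0) => //; case: (T0_least hT). Qed.

Lemma near_top_gt b : Psi0 b -> near_top (fun e => Psi e /\ b < e).
Proof.
move=> hb; have [h1 h2 _] := Psi0_s hb.
by exists (s b) => // e he; split=> //; apply: lt_le_trans h2 _.
Qed.

(* Specialization of eps at [e]; orders and values in [hat] are those of the
   specializations at all large enough elements of Psi. *)
Definition at_ (x : hat) (e : G) : G := (x.1 : G) + qmul x.2 e.

Lemma at_lin q (x y : hat) e : at_ (q *: x + y) e = qmul q (at_ x e) + at_ y e.
Proof.
rewrite /at_ /qmul; set x1 : qspace hD := x.1; set y1 : qspace hD := y.1.
change ((q *: x1 + y1) + (q * x.2 + y.2) *: (e : qspace hD) =
  q *: (x1 + x.2 *: (e : qspace hD)) + (y1 + y.2 *: (e : qspace hD))).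
by rewrite scalerDr scalerDl scalerA addrACA.
Qed.

Lemma at_0 e : at_ 0 e = 0.
Proof.
rewrite /at_ /qmul; change ((0 : qspace hD) + 0 *: (e : qspace hD) = 0).
by rewrite scale0r addr0.
Qed.

Lemma at_D (x y : hat) e : at_ (x + y) e = at_ x e + at_ y e.
Proof.
have := at_lin 1 x y e; rewrite scale1r => ->; congr (_ + _).
exact: (scale1r (at_ x e : qspace hD)).
Qed.

Lemma at_Z q (x : hat) e : at_ (q *: x) e = qmul q (at_ x e).
Proof. by have := at_lin q x 0 e; rewrite at_0 !addr0. Qed.

Lemma at_N (x : hat) e : at_ (- x) e = - at_ x e.
Proof. by apply/eqP; rewrite -addr_eq0 -at_D addNr at_0. Qed.

Lemma at_B (x y : hat) e : at_ (x - y) e = at_ x e - at_ y e.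
Proof. by rewrite at_D at_N. Qed.

Lemma qmul_sign q a : q != 0 -> a != 0 -> (0 < qmul q a) = ((0 < q) == (0 < a)).
Proof.
have scN p b : qmul p b = - qmul (- p) b.
  by rewrite /qmul (scaleNr p (b : qspace hD)) opprK.
have scN' p b : qmul p (- b) = - qmul p b by rewrite /qmul (scalerN p (b : qspace hD)).
have gt0N b : 0 < b -> (0 < - b) = false.
  by move=> b0; rewrite (oag_oppr_gt0 hG); apply/negbTE; rewrite -(oag_leNgt hG) ltW.
have pc p b : 0 < p -> b != 0 -> (0 < qmul p b) = (0 < b).
  move=> p0 /(oag_gt0_or_lt0 hG)[b0|b0]; first by rewrite b0 qmul_gt0.
  have nb : 0 < - b by rewrite (oag_oppr_gt0 hG).
  rewrite -[b]opprK scN' (gt0N (- b)) // gt0N //; exact: qmul_gt0.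
move=> q0 a0; have [qn|qp|qe] := ltgtP q 0; last by rewrite qe eqxx in q0.
  rewrite scN -scN' pc ?oppr_gt0 ?oppr_eq0 //.
  rewrite (oag_oppr_gt0 hG); case: (oag_gt0_or_lt0 hG a0) => h; rewrite h.
    by apply/negbTE; rewrite -(oag_leNgt hG) ltW.
  by apply/esym/eqP/esym/negbTE; rewrite -(oag_leNgt hG) ltW.
by rewrite pc.
Qed.

(** If the coefficient q of eps is nonzero, then x = q (eps - b) for some b in Gamma and [psi_tail]
    applies. This stability makes order and valuation total on [hat], although [near_top] only
    refers to final segments of Psi. *)
Lemma at_value (x : hat) : x != 0 -> exists2 y, Psi y & exists sg : bool,
  near_top (fun e => [/\ at_ x e != 0, psi (at_ x e) = y & (0 < at_ x e) = sg]).
Proof.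
move=> x0; have [q0|q0] := eqVneq x.2 0.
  have x10 : (x.1 : G) != 0.
    apply: contraNneq x0 => e; apply/eqP; case: x e q0 => x1 x2 /= -> ->; by [].
  exists (psi x.1); first by exists x.1.
  exists (0 < (x.1 : G)); apply: near_top_all => e.
  by rewrite /at_ /qmul q0 (scale0r (e : qspace hD)) addr0.
pose b : G := - qmul x.2^-1 x.1.
have ate e : at_ x e = qmul x.2 (e - b).
  rewrite /at_ /qmul /b opprK; set x1 : qspace hD := x.1.
  change (x1 + x.2 *: (e : qspace hD) = x.2 *: ((e : qspace hD) + x.2^-1 *: x1)).
  by rewrite scalerDr scalerA mulfV // scale1r addrC.
have [_ _ sb] := s_spec b.
exists (s b) => //; exists ((0 < x.2) == (0 < s b - b)).
apply: near_top_mono (near_top_gt (or_intror sb)) => e [he be].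
have [h1 h2 h3] := psi_tail he be.
rewrite ate qmul_neq0 // psi_qmul // qmul_sign //; split=> //; congr (_ == _).
by apply/idP/idP; apply h3.
Qed.

(** Here 0 has the value infinity; [psi] must not be consulted at 0, where its value is
    arbitrary. *)
Definition psi_le (a b : G) : Prop := a = 0 \/ (b != 0 /\ (a != 0 -> psi b <= psi a)).

Definition hat_mark (g : G) : hat := (- g : qspace hD, 1 : rat^o).

Definition hat_data : valued_data hat := {|
  pos (u : hat) := near_top (fun e => 0 < at_ u e);
  dom (u v : hat) := near_top (fun e => psi_le (at_ u e) (at_ v e));
  mark (u : hat) := exists2 g, Psi0 g & u = hat_mark g;
  (* For u = eps - g, the negated first coordinate is the index g. *)
  nxt (u : hat) := hat_mark (s (- (u.1 : G)));
  eps := hat_mark 0;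
  gam (u : hat) := u.2 = 0 |}.

Local Notation E := hat_data.

Lemma hat_null (x : hat) : null E x <-> x = 0.
Proof.
split=> [[h1 h2]|->].
  apply: contrapT => /eqP /at_value[y _ [sg h]]; case: sg h => h.
    by apply: h1; apply: near_top_mono h => e [].
  apply: h2; apply: near_top_mono h => e [e1 _ e2]; rewrite at_N (oag_oppr_gt0 hG).
  by case: (oag_gt0_or_lt0 hG e1) => //; rewrite e2.
by rewrite /null oppr0; split=> /near_top_ex[e]; rewrite at_0 ltxx.
Qed.

Lemma hat_sim (x y : hat) : sim E x y <-> x = y.
Proof.
rewrite /sim hat_null; split=> [/eqP|->]; last by rewrite subrr.
by rewrite subr_eq0 => /eqP.
Qed.

Lemma hat_nonneg (x : hat) : ~ pos E (- x) <-> near_top (fun e => 0 <= at_ x e).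
Proof.
split=> h; last first.
  move=> h'; have /near_top_ex[e] : near_top (fun=> False); last by [].
  apply: near_top_mono2 h h' => e h1; rewrite at_N (oag_oppr_gt0 hG) => /(le_lt_trans h1).
  by rewrite ltxx.
have [->|x0] := eqVneq x 0; first by apply: near_top_all => e; rewrite at_0.
have [y _ [sg k]] := at_value x0; case: sg k => k.
  by apply: near_top_mono k => e [_ _ /ltW].
case: h; apply: near_top_mono k => e [e1 _ e2]; rewrite at_N (oag_oppr_gt0 hG).
by case: (oag_gt0_or_lt0 hG e1) => //; rewrite e2.
Qed.

Lemma psi_le_trans a b c : psi_le a b -> psi_le b c -> psi_le a c.
Proof.
move=> [->|[b0 ab]]; first by left.
move=> [b0'|[c0 bc]]; first by rewrite b0' eqxx in b0.
by right; split=> // a0; apply: le_trans (bc b0) (ab a0).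
Qed.

Lemma psi_le_add a b c : psi_le a c -> psi_le b c -> psi_le (a + b) c.
Proof.
move=> [->|[c0 ac]]; first by rewrite add0r.
move=> [->|[_ bc]]; first by rewrite addr0; right.
right; split=> // ab0.
have [a0|a0] := eqVneq a 0.
  by move: ab0; rewrite a0 add0r; exact: bc.
have [b0|b0] := eqVneq b 0.
  by move: ab0; rewrite b0 addr0; exact: ac.
by apply: psiD; [| | |exact: ac|exact: bc].
Qed.

Lemma psi_le_qmul q a : psi_le (qmul q a) a.
Proof.
have [->|q0] := eqVneq q 0.
  by left; rewrite /qmul (scale0r (a : qspace hD)).
have [->|a0] := eqVneq a 0.
  by left; rewrite /qmul (scaler0 (qspace hD) q).
by right; split=> // _; rewrite psi_qmul.
Qed.

Lemma psi_le_convex a b : 0 <= a -> a <= b -> psi_le a b.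
Proof.
move=> a0 ab; have [->|an] := eqVneq a 0; first by left.
have a1 : 0 < a by rewrite lt_neqAle eq_sym an.
right; split=> [|_]; last exact: (T0_H hT).
by rewrite gt_eqF // (lt_le_trans a1).
Qed.

Lemma hat_dom_value (x y : hat) u v : Psi u -> Psi v ->
  near_top (fun e => at_ x e != 0 /\ psi (at_ x e) = u) ->
  near_top (fun e => at_ y e != 0 /\ psi (at_ y e) = v) ->
  dom E x y <-> v <= u.
Proof.
move=> hu hv hx hy; split=> [h|h].
  have /near_top_ex[e //] : near_top (fun=> v <= u).
  apply: near_top_mono3 h hx hy => e [->|[h1 h2]] [k1 <-] [k3 <-]; last exact: h2.
  by rewrite eqxx in k1.
by apply: near_top_mono2 hx hy => e [k1 k2] [k3 k4]; right; split=> // _; rewrite k2 k4.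
Qed.

Lemma at_psi (x : hat) : x != 0 -> exists2 y, Psi y &
  near_top (fun e => at_ x e != 0 /\ psi (at_ x e) = y).
Proof.
by move=> /at_value[y hy [sg h]]; exists y => //; apply: near_top_mono h => e [].
Qed.

Lemma at_mark g e : at_ (hat_mark g) e = e - g.
Proof.
rewrite /at_ /qmul /=; change (- (g : qspace hD) + 1 *: (e : qspace hD) = (e : qspace hD) - g).
by rewrite scale1r addrC.
Qed.

Lemma hat_mark_value g : Psi0 g ->
  near_top (fun e => at_ (hat_mark g) e != 0 /\ psi (at_ (hat_mark g) e) = s g).
Proof.
move=> hg; apply: near_top_mono (near_top_gt hg) => e [he ge]; rewrite at_mark.
by split; [rewrite gt_eqF // (oag_subr_gt0 hG)|exact: psi_sub].
Qed.

Lemma Psi_s g : Psi0 g -> Psi (s g).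
Proof. by case/Psi0_s. Qed.

Lemma hat_mark_dom g h : Psi0 g -> Psi0 h -> dom E (hat_mark g) (hat_mark h) <-> h <= g.
Proof.
move=> hg hh; rewrite -(s_mono hh hg).
by apply: hat_dom_value; (apply: Psi_s || apply: hat_mark_value).
Qed.

Lemma hat_mark_inj g h : hat_mark g = hat_mark h -> g = h.
Proof. by case=> /oppr_inj. Qed.

Lemma hat_dom0 (x : hat) : dom E x 0 -> x = 0.
Proof.
move=> h; apply/eqP; apply: contrapT => /negP /at_psi[y _ k].
have /near_top_ex[e //] : near_top (fun=> False).
apply: near_top_mono2 h k => e; rewrite at_0 => -[->|[]]; last by rewrite eqxx.
by case; rewrite eqxx.
Qed.

Lemma hat_nxt g : nxt E (hat_mark g) = hat_mark (s g).
Proof. by rewrite /= opprK. Qed.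

Lemma hat_laws : valued_laws E.
Proof.
split.
- move=> x h; rewrite hat_nonneg; apply: near_top_mono h => e; exact: ltW.
- move=> x y; rewrite !hat_nonneg; apply: near_top_mono2 => e h1 h2; rewrite at_D.
  exact: (oag_addr_ge0 hG).
- by move=> q x q0; apply: near_top_mono => e h; rewrite at_Z; apply: qmul_gt0.
- move=> x y; have [->|x0] := eqVneq x 0.
    by left; apply: near_top_all => e; rewrite at_0; left.
  have [->|y0] := eqVneq y 0; first by right; apply: near_top_all => e; rewrite at_0; left.
  have [u hu ku] := at_psi x0; have [v hv kv] := at_psi y0.
  rewrite (hat_dom_value hu hv ku kv) (hat_dom_value hv hu kv ku).
  exact/orP/(oag_total hG).
- by move=> x y z; apply: near_top_mono2 => e; apply: psi_le_trans.
- by move=> x y z; apply: near_top_mono2 => e; rewrite at_D; apply: psi_le_add.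
- by move=> q x; apply: near_top_all => e; rewrite at_Z; apply: psi_le_qmul.
- move=> x y; rewrite -opprB !hat_nonneg; apply: near_top_mono2 => e h; rewrite at_B.
  by rewrite (oag_subr_ge0 hG); apply: psi_le_convex.
- by move=> x y; rewrite !hat_null => -> /hat_dom0.
- move=> c [g hg ->]; apply: near_top_mono (near_top_gt hg) => e [_].
  by rewrite at_mark (oag_subr_gt0 hG).
- move=> c d [g hg ->] [h hh ->]; rewrite /eqval !hat_mark_dom // hat_sim => -[h1 h2].
  by congr hat_mark; apply/eqP; rewrite eq_le h1 h2.
- by move=> c d h /hat_sim <-.
- move=> x; rewrite hat_null => /eqP /at_psi[y hy hx].
  have [g hg gy] := Psi_pred hy.
  have hv := hat_mark_value hg; have hs := Psi_s hg.
  exists (hat_mark g); first by exists g.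
  split; first by rewrite (hat_dom_value hy hs hx hv) gy.
  by rewrite (hat_dom_value hs hy hv hx) gy.
- by move=> c [g hg ->]; exists (s g); [right; apply: Psi_s|rewrite hat_nxt].
- move=> c d [g hg ->] [h hh ->].
  have sg := Psi_s hg; rewrite hat_nxt hat_mark_dom //; last by right.
  by rewrite hat_mark_dom // s_lt // (oag_ltNge hG); split=> /negP.
- by exists 0 => //; left.
- by move=> c [g hg ->]; rewrite hat_mark_dom //; [apply: Psi0_ge0|left].
- move=> c [g hg ->]; case: (hg) => [->|/Psi_pred[h hh <-]]; rewrite hat_sim; first by left.
  by right; exists (hat_mark h); [exists h|rewrite hat_sim hat_nxt].
- by move=> q x y /= h1 h2; rewrite h1 h2 scaler0 addr0.
- by move=> x y /hat_sim ->.
- by move=> c [g hg ->] /=; rewrite subrr.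
- move=> x c [g hg ->].
  have sg := Psi_s hg; have sg0 : Psi0 (s g) by right.
  (* The subtraction cancels eps. The subtracted term is 0 or has value s (s g), beyond the value s
     g of the mark c. *)
  exists (x - x.2 *: hat_mark (s g)).
    by rewrite /= -[_ *: 1]/(x.2 * 1) mulr1 subrr.
  rewrite opprB addrC subrK; have [->|q0] := eqVneq x.2 0.
    by rewrite scale0r => /hat_dom0; case=> _ /eqP; rewrite oner_eq0.
  have hv : near_top (fun e => at_ (x.2 *: hat_mark (s g)) e != 0 /\
      psi (at_ (x.2 *: hat_mark (s g)) e) = s (s g)).
    apply: near_top_mono (hat_mark_value sg0) => e [h1 h2]; rewrite at_Z.
    by rewrite psi_qmul // qmul_neq0.
  rewrite (hat_dom_value sg (Psi_s sg0) (hat_mark_value hg) hv).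
  rewrite (s_mono sg0 hg); apply/negP; rewrite -(oag_ltNge hG).
  by have [_ ? _] := Psi0_s hg.
Qed.

End Base.

(** * Back and forth *)

Section Formulas.
Variables (G : porderZmodType) (D : log_structure G) (hD : models_Tlog D).
Variables (U : (nat -> Prop) -> Prop) (fU : free_ultrafilter U).

Local Notation psi := (lpsi D).
Local Notation s := (ls D).
Local Notation Psi := (Psi psi).
Local Notation H := (hat_data hD).
Local Notation V := (nat -> hat hD).

Let hT := Tlog_T0 hD.
Let hG := ac_group (T0_couple hT).

Definition star := ultra_data U H.
Definition star_laws : valued_laws star := ultra_laws fU (hat_laws hD).
Definition star_sat := ultra_saturated fU H.

Definition emb0 (g : G) : hat hD := (g : qspace hD, 0 : rat^o).
Definition emb (a : nat -> G) : V := fun n => emb0 (a n).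

Lemma star_sim (x y : V) : sim star x y <-> U (fun n => x n = y n).
Proof.
rewrite ultra_sim //; split; apply: (U_mono fU) => n; rewrite hat_sim //.
Qed.

Lemma at_emb0 g e : at_ (emb0 g) e = g.
Proof.
rewrite /at_ /qmul /=; change ((g : qspace hD) + 0 *: (e : qspace hD) = g).
by rewrite scale0r addr0.
Qed.

Lemma pos_emb0 g : pos H (emb0 g) <-> 0 < g.
Proof.
split=> [/near_top_ex[e]|h]; first by rewrite at_emb0.
by apply: near_top_all => // e; rewrite at_emb0.
Qed.

Lemma emb0_value g : g != 0 ->
  near_top D (fun e => at_ (emb0 g) e != 0 /\ psi (at_ (emb0 g) e) = psi g).
Proof. by move=> g0; apply: near_top_all => // e; rewrite at_emb0. Qed.

(** The mark c is eps - g with s g = y, so its successor is eps - y. Thus a value, read as a group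
    element, is recovered linearly from marks. *)
Lemma eqval_mark_value (x c : hat hD) y : Psi y ->
  near_top D (fun e => at_ x e != 0 /\ psi (at_ x e) = y) ->
  mark H c -> eqval H x c -> eps H - nxt H c = emb0 y.
Proof.
move=> hy hx [g hg ->] [h1 h2]; rewrite hat_nxt.
have hs := Psi_s hD hg; have hv := hat_mark_value hD hg.
have e : y = s g.
  apply/eqP; rewrite eq_le.
  rewrite (hat_dom_value hy hs hx hv) in h1.
  by rewrite (hat_dom_value hs hy hv hx) in h2; rewrite h1 h2.
rewrite e [LHS]surjective_pairing /emb0; congr (_, _) => /=.
by rewrite oppr0 add0r opprK.
Qed.

Lemma hat_psi g (c : hat hD) : g != 0 -> mark H c -> eqval H (emb0 g) c ->
  eps H - nxt H c = emb0 (psi g).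
Proof.
by move=> g0; apply: eqval_mark_value; [exists g|exact: emb0_value].
Qed.

(** By [psi_tail], s g is the value of g - eps. *)
Lemma hat_s g (c : hat hD) : mark H c -> eqval H (emb0 g - eps H) c ->
  eps H - nxt H c = emb0 (s g).
Proof.
have [_ _ sg] := s_spec hD g; apply: eqval_mark_value => //.
apply: (near_top_mono _ (near_top_gt hD (or_intror sg))) => e [he ge].
have [h1 h2 _] := psi_tail hD he ge.
rewrite at_B at_emb0 at_mark subr0 -opprB oppr_eq0; split=> //.
by rewrite psiN.
Qed.

Lemma lp_succ g : Psi g -> lp D (Some (s g)) = Some g.
Proof. exact: (Tlog_p hD). Qed.

Lemma lp_none g : ~ (exists2 h, Psi h & g = s h) -> lp D (Some g) = None.
Proof.
move=> no; apply: (Tlog_p_default hD) => -[x hx [e]]; apply: no.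
by have [h h1 h2] := T0_surj hT hx; exists h => //; rewrite e h2.
Qed.

Lemma lp_infty : lp D None = None.
Proof. by apply: (Tlog_p_default hD) => -[]. Qed.

(** A sequence is infinite almost everywhere or finite almost everywhere, so infinity can be kept
    out of [position]. *)
Definition opt_rel (R : V -> V -> Prop) (o o' : nat -> option G) : Prop :=
  U (fun n => o n = None /\ o' n = None) \/
  exists a b, R (emb a) (emb b) /\ U (fun n => o n = Some (a n) /\ o' n = Some (b n)).

Definition env_rel R (e e' : nat -> nat -> option G) : Prop :=
  forall v, opt_rel R (fun n => e n v) (fun n => e' n v).

Lemma opt_rel_mono (R R' : V -> V -> Prop) o o' : (forall x y, R x y -> R' x y) ->
  opt_rel R o o' -> opt_rel R' o o'.
Proof. by move=> h [?|[a [b [h1 h2]]]]; [left|right; exists a, b; split=> //; apply: h]. Qed.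

Lemma env_rel_mono (R R' : V -> V -> Prop) e e' : (forall x y, R x y -> R' x y) ->
  env_rel R e e' -> env_rel R' e e'.
Proof. by move=> h he v; apply: opt_rel_mono h (he v). Qed.

Lemma opt_rel_inv R o o' : opt_rel R o o' -> opt_rel (fun x y => R y x) o' o.
Proof.
case=> [h|[a [b [h1 h2]]]]; [left|right; exists b, a; split=> //];
  by [apply: (U_mono fU) h => n []|apply: (U_mono fU) h2 => n []].
Qed.

Lemma emb_gam (x : V) : gam star x -> sim star x (emb (fun n => (x n).1)).
Proof.
rewrite star_sim; apply: (U_mono fU) => n; rewrite /emb /emb0.
by case: (x n) => x1 x2 /= ->.
Qed.

Lemma gam_emb a : gam star (emb a).
Proof. by apply: (U_all fU). Qed.

Lemma R_emb R (x y : V) : position star R -> R x y -> gam star x ->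
  R (emb (fun n => (x n).1)) (emb (fun n => (y n).1)).
Proof.
move=> pR h gx; apply: (R_sim pR h); apply: emb_gam => //.
by rewrite -(R_gam pR h).
Qed.

Lemma forth_opt R o : position star R -> exists R' o',
  [/\ position star R', (forall x y, R x y -> R' x y) & opt_rel R' o o'].
Proof.
move=> pR; have [h|h] := U_dec fU (fun n => o n = None).
  by exists R, (fun=> None); split=> //; left; apply: (U_mono fU) h.
have [R' [b [pR' sub Rab gb]]] := forth star_laws star_sat pR (gam_emb (fun n => odflt 0 (o n))).
exists R', (fun n => Some (b n).1); split=> //; right.
exists (fun n => odflt 0 (o n)), (fun n => (b n).1); split.
  exact: (R_emb pR' Rab (gam_emb _)).
by apply: (U_mono fU) h => n; case: (o n).
Qed.

Lemma emb_mark_gam R c c' : position star R -> R c c' -> mark star c -> mark star c' ->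
  R (emb (fun n => (eps star n - c n).1)) (emb (fun n => (eps star n - c' n).1)).
Proof.
move=> pR h Wc Wc'; apply: (R_emb pR (R_sub pR (R_eps pR) h)).
have := gamZ star_laws (-1) (gam_eps star_laws Wc); by rewrite scaleN1r opprB.
Qed.

Lemma R_nxt R c c' d d' : position star R -> R c c' -> R d d' ->
  mark star c -> mark star d -> sim star c (nxt star d) -> sim star c' (nxt star d').
Proof.
move=> pR h1 h2 Wc Wd h.
have Wc' := R_mark star_laws pR h1 Wc; have Wd' := R_mark star_laws pR h2 Wd.
apply: (mark_eq star_laws) => //; first exact: (nxt_mark star_laws).
have [e1 e2] := sim_eqval star_laws h.
split.
  exact/(R_typ2 star_laws 0 1 pR h2 h1 Wd Wc).
exact/(R_typ2 star_laws 1 0 pR h1 h2 Wc Wd).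
Qed.

Lemma add_nxt R d d' : position star R -> R d d' -> mark star d -> exists R',
  [/\ position star R', (forall x y, R x y -> R' x y) & R' (nxt star d) (nxt star d')].
Proof.
move=> pR h Wd; have Wn := nxt_mark star_laws Wd.
have [R' [n' [pR' sub h' _]]] := extend_mark star_laws star_sat pR Wn.
exists R'; split=> //; apply: (R_sim pR' h') (sim_refl star_laws _) _.
exact: (R_nxt pR' h' (sub _ _ h) Wn Wd (sim_refl star_laws _)).
Qed.

(** Common to [psi], with x = a, and to [s], with x = a - eps. A domain contains the marks of its
    values but perhaps not their successors, so one successor has to be added. *)
Lemma add_value R x x' (f f' : nat -> G) : position star R -> R x x' -> ~ null star x ->
  (forall c, mark star c -> eqval star x c ->
     U (fun n => eps star n - nxt star c n = emb0 (f n))) ->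
  (forall c, mark star c -> eqval star x' c ->
     U (fun n => eps star n - nxt star c n = emb0 (f' n))) ->
  exists R', [/\ position star R', (forall x y, R x y -> R' x y) & R' (emb f) (emb f')].
Proof.
move=> pR h nz hf hf'; have [c [c' [Rc Wc Wc' xc xc']]] := R_val pR h nz.
have [R' [pR' sub Rn]] := add_nxt pR Rc Wc; exists R'; split=> //.
have := R_sub pR' (R_eps pR') Rn; move/(R_sim pR'); apply.
  by rewrite star_sim; exact: hf.
by rewrite star_sim; exact: hf'.
Qed.

Lemma eps_emb0 g : eps H - emb0 g = hat_mark hD g.
Proof.
rewrite [LHS]surjective_pairing /hat_mark; congr (_, _) => /=.
by rewrite oppr0 add0r.
Qed.

Lemma fst_eps_mark g : (eps H - hat_mark hD g).1 = g :> G.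
Proof. by rewrite /= oppr0 add0r opprK. Qed.

(** As eps - x is the mark of index x, the last clause says that x is s of the index of d. The
    second excludes index 0, because p is infinite at s0. *)
Definition predecessor (x d : V) :=
  [/\ mark star d, ~ sim star d (eps star) & sim star (eps star - x) (nxt star d)].

Lemma predecessor_lp a d : predecessor (emb a) d ->
  U (fun n => lp D (Some (a n)) = Some ((eps star - d) n).1).
Proof.
case=> h1 h2 h3; rewrite star_sim -(U_not fU) in h2; rewrite star_sim in h3.
apply: (U_mono3 fU) h1 h2 h3 => n [g hg e] ng k.
have {}k : eps H - emb0 (a n) = nxt H (d n) := k.
have -> : (eps star - d) n = eps H - d n by [].
move: k; rewrite e eps_emb0 hat_nxt => /hat_mark_inj ->; rewrite fst_eps_mark.
apply: lp_succ; case: hg => // g0; case: ng; by rewrite e g0.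
Qed.

Lemma no_predecessor_lp a : ~ (exists d, predecessor (emb a) d) ->
  U (fun n => lp D (Some (a n)) = None).
Proof.
move=> no; case: (U_dec fU (fun n => exists h, Psi h /\ a n = s h)); last first.
  by apply: (U_mono fU) => n h; apply: lp_none => -[g h1 h2]; apply: h; exists g.
move=> /(U_ex fU _ 0)[h]; rewrite (U_andE fU) => -[h1 h2]; case: no.
exists (fun n => hat_mark hD (h n)); split.
- by apply: (U_mono fU) h1 => n; exists (h n) => //; right.
- rewrite star_sim -(U_not fU); apply: (U_mono fU) h1 => n /(Psi_gt0 hD) h0.
  by move=> /hat_mark_inj e; rewrite e ltxx in h0.
- rewrite star_sim; apply: (U_mono fU) h2 => n e.
  have -> : (eps star - emb a) n = eps H - emb0 (a n) by [].
  by rewrite eps_emb0 e -hat_nxt.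
Qed.

Lemma extend_predecessor R x y d : position star R -> R x y -> predecessor x d ->
  exists R' d', [/\ position star R', (forall x y, R x y -> R' x y), R' d d' &
    predecessor y d'].
Proof.
move=> pR Rxy [Wd nd xd].
have [R' [d' [pR' sub Rd Wd']]] := extend_mark star_laws star_sat pR Wd.
exists R', d'; split=> //; split=> //.
  by rewrite -(R_simE pR' Rd (R_eps pR')).
have h := R_sub pR' (R_eps pR') (sub _ _ Rxy).
apply: (R_nxt pR' h Rd _ Wd xd).
exact: (mark_sim star_laws) (nxt_mark star_laws Wd) (sim_sym xd).
Qed.

(** Whether p is finite is decided by the existence of a predecessor mark; this passes from a to b
    by extending R, and back by extending its inverse. *)
Lemma opt_rel_p R a b : position star R -> R (emb a) (emb b) ->
  exists R', [/\ position star R', (forall x y, R x y -> R' x y) &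
    opt_rel R' (fun n => lp D (Some (a n))) (fun n => lp D (Some (b n)))].
Proof.
move=> pR Rab; case: (pselect (exists d, predecessor (emb a) d)) => [[d hd]|no].
  have [R' [d' [pR' sub Rd hd']]] := extend_predecessor pR Rab hd.
  have [Wd _ _] := hd; have [Wd' _ _] := hd'.
  exists R'; split=> //; right; have h := emb_mark_gam pR' Rd Wd Wd'.
  exists (fun n => (eps star n - d n).1), (fun n => (eps star n - d' n).1); split=> //.
  by apply: (U_mono2 fU) (predecessor_lp hd) (predecessor_lp hd').
exists R; split=> //; left.
apply: (U_and fU); first exact: no_predecessor_lp.
apply: no_predecessor_lp => -[d hd].
have [R' [d' [_ _ _ hd']]] := extend_predecessor (position_inv pR) Rab hd.
by apply: no; exists d'.
Qed.

Lemma emb_null a : null star (emb a) <-> U (fun n => a n = 0).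
Proof.
rewrite (ultra_null fU); split; apply: (U_mono fU) => n; rewrite hat_null.
  by case.
by rewrite /emb => ->.
Qed.

Lemma psi_infty_some a : ~ null star (emb a) ->
  U (fun n => psi_infty psi (Some (a n)) = Some (psi (a n))).
Proof.
rewrite emb_null -(U_not fU); apply: (U_mono fU) => n /eqP h.
by rewrite /= (negbTE h).
Qed.

Lemma psi_infty_none a : null star (emb a) ->
  U (fun n => psi_infty psi (Some (a n)) = None).
Proof. by rewrite emb_null; apply: (U_mono fU) => n -> /=; rewrite eqxx. Qed.

Lemma emb_psi a c : ~ null star (emb a) -> mark star c -> eqval star (emb a) c ->
  U (fun n => eps star n - nxt star c n = emb0 (psi (a n))).
Proof.
rewrite emb_null -(U_not fU) (ultra_eqval fU) => h1 h2.
apply: (U_mono3 fU) h1 h2 => n /eqP; exact: hat_psi.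
Qed.

Lemma emb_s a c : mark star c -> eqval star (emb a - eps star) c ->
  U (fun n => eps star n - nxt star c n = emb0 (s (a n))).
Proof.
by rewrite (ultra_eqval fU); apply: (U_mono2 fU) => n; apply: hat_s.
Qed.

Lemma emb_eps a : ~ null star (emb a - eps star).
Proof.
rewrite (ultra_null fU) -(U_not fU); apply: (U_all fU) => n; rewrite hat_null.
by move=> /(congr1 snd) /= /eqP; rewrite sub0r oppr_eq0 oner_eq0.
Qed.

Lemma ldelta_qmul n g : ldelta D n g = qmul hD (n.+1%:R^-1) g.
Proof.
apply: (qscaleP (Tlog_delta hD) (oag_torsion_free hG) (n := n.+1) (m := 1)) => //.
  by rewrite -[n.+1%:~R]/(n.+1%:R : rat) mulVf // pnatr_eq0.
exact: (Tlog_delta hD).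
Qed.

(** Values of subterms may leave the domain, so the position grows with the term while keeping the
    old pairs. *)
Lemma term_rel t : forall R e e', position star R -> env_rel R e e' ->
  exists R', [/\ position star R', (forall x y, R x y -> R' x y) &
    opt_rel R' (fun n => eval D (e n) t) (fun n => eval D (e' n) t)].
Proof.
elim: t => [v|||t1 IH1 t2 IH2|t IH|t IH|t IH|t IH|k t IH] R e e' pR he.
- by exists R; split=> //; apply: he.
- exists R; split=> //; right; exists (fun=> 0), (fun=> 0).
  by split; [apply: (R_0 pR)|apply: (U_all fU)].
- by exists R; split=> //; left; apply: (U_all fU).
- have [R1 [p1 s1 o1]] := IH1 _ _ _ pR he.
  have [R2 [p2 s2 o2]] := IH2 _ _ _ p1 (env_rel_mono s1 he).
  exists R2; split=> // [x y /s1/s2 //|].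
  case: o1 => [h1|[a1 [b1 [r1 h1]]]].
    by left; apply: (U_mono fU) h1 => n /= [-> ->].
  case: o2 => [h2|[a2 [b2 [r2 h2]]]].
    by left; apply: (U_mono2 fU) h1 h2 => n /= [-> ->] [-> ->].
  right; exists (fun n => a1 n + a2 n), (fun n => b1 n + b2 n); split.
    have h := R_add p2 (s2 _ _ r1) r2; apply: (R_sim p2 h); rewrite star_sim;
      apply: (U_all fU) => n.
      by rewrite [LHS]surjective_pairing /emb /emb0 /= addr0.
    by rewrite [LHS]surjective_pairing /emb /emb0 /= addr0.
  by apply: (U_mono2 fU) h1 h2 => n /= [-> ->] [-> ->].
- have [R1 [p1 s1 o1]] := IH _ _ _ pR he; exists R1; split=> //.
  case: o1 => [h1|[a1 [b1 [r1 h1]]]].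
    by left; apply: (U_mono fU) h1 => n /= [-> ->].
  right; exists (fun n => - a1 n), (fun n => - b1 n); split.
    have h := R_opp p1 r1; apply: (R_sim p1 h); rewrite star_sim; apply: (U_all fU) => n.
      by rewrite [LHS]surjective_pairing /emb /emb0 /= oppr0.
    by rewrite [LHS]surjective_pairing /emb /emb0 /= oppr0.
  by apply: (U_mono fU) h1 => n /= [-> ->].
- have [R1 [p1 s1 o1]] := IH _ _ _ pR he.
  case: o1 => [h1|[a1 [b1 [r1 h1]]]].
    by exists R1; split=> //; left; apply: (U_mono fU) h1 => n /= [-> ->].
  case: (pselect (null star (emb a1))) => z.
    exists R1; split=> //; left; have z' : null star (emb b1) by rewrite -(R_null p1 r1).
    apply: (U_mono3 fU) h1 (psi_infty_none z) (psi_infty_none z') => n [h h'] k k'.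
    by rewrite /= h h'; split; [exact: k|exact: k'].
  have z' : ~ null star (emb b1) by rewrite -(R_null p1 r1).
  have [||R2 [p2 s2 r2]] :=
    @add_value R1 _ _ (fun n => psi (a1 n)) (fun n => psi (b1 n)) p1 r1 z.
  + by move=> c; apply: emb_psi.
  + by move=> c; apply: emb_psi.
  exists R2; split=> [//|x y /s1/s2 //|]; right.
  exists (fun n => psi (a1 n)), (fun n => psi (b1 n)); split=> //.
  apply: (U_mono3 fU) h1 (psi_infty_some z) (psi_infty_some z') => n [h h'] k k'.
  by rewrite /= h h'; split; [exact: k|exact: k'].
- have [R1 [p1 s1 o1]] := IH _ _ _ pR he.
  case: o1 => [h1|[a1 [b1 [r1 h1]]]].
    by exists R1; split=> //; left; apply: (U_mono fU) h1 => n /= [-> ->].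
  have [||R2 [p2 s2 r2]] := @add_value R1 _ _ (fun n => s (a1 n)) (fun n => s (b1 n)) p1
    (R_sub p1 r1 (R_eps p1)) (@emb_eps a1).
  + by move=> c; apply: emb_s.
  + by move=> c; apply: emb_s.
  exists R2; split=> [//|x y /s1/s2 //|]; right.
  exists (fun n => s (a1 n)), (fun n => s (b1 n)); split=> //.
  by apply: (U_mono fU) h1 => n /= [-> ->].
- have [R1 [p1 s1 o1]] := IH _ _ _ pR he.
  case: o1 => [h1|[a1 [b1 [r1 h1]]]].
    exists R1; split=> //; left.
    by apply: (U_mono fU) h1 => n /= [-> ->]; rewrite lp_infty.
  have [R2 [p2 s2 o2]] := opt_rel_p p1 r1.
  exists R2; split=> [//|x y /s1/s2 //|].
  case: o2 => [h2|[a2 [b2 [r2 h2]]]]; [left|right].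
    by apply: (U_mono2 fU) h1 h2 => n /= [-> ->].
  by exists a2, b2; split=> //; apply: (U_mono2 fU) h1 h2 => n /= [-> ->].
- have [R1 [p1 s1 o1]] := IH _ _ _ pR he; exists R1; split=> //.
  case: o1 => [h1|[a1 [b1 [r1 h1]]]].
    by left; apply: (U_mono fU) h1 => n /= [-> ->].
  right; exists (fun n => ldelta D k (a1 n)), (fun n => ldelta D k (b1 n)); split.
    have h := R_scale p1 (k.+1%:R^-1) r1; apply: (R_sim p1 h); rewrite star_sim;
      apply: (U_all fU) => n; rewrite [LHS]surjective_pairing /emb /emb0 /=;
      by rewrite ldelta_qmul scaler0.
  by apply: (U_mono fU) h1 => n /= [-> ->].
Qed.

Lemma sim_emb a b : sim star (emb a) (emb b) <-> U (fun n => a n = b n).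
Proof.
rewrite star_sim; split; apply: (U_mono fU) => n; rewrite /emb; first by case.
by move=> ->.
Qed.

Lemma pos_emb a b : pos star (emb b - emb a) <-> U (fun n => a n < b n).
Proof.
split; apply: (U_mono fU) => n.
  have -> : (emb b - emb a) n = emb0 (b n - a n).
    by rewrite [LHS]surjective_pairing /emb /emb0 /= subrr.
  by rewrite pos_emb0 (oag_subr_gt0 hG).
have -> : (emb b - emb a) n = emb0 (b n - a n).
  by rewrite [LHS]surjective_pairing /emb /emb0 /= subrr.
by rewrite pos_emb0 (oag_subr_gt0 hG).
Qed.

Lemma env_rel_cons R o o' e e' : opt_rel R o o' -> env_rel R e e' ->
  env_rel R (fun n => env_cons (o n) (e n)) (fun n => env_cons (o' n) (e' n)).
Proof. by move=> ho he [|v] //=; apply: he. Qed.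

Lemma env_rel_inv R e e' : env_rel R e e' -> env_rel (fun x y => R y x) e' e.
Proof. by move=> he v; apply: opt_rel_inv (he v). Qed.

Lemma eq_rel R o1 o1' o2 o2' : position star R -> opt_rel R o1 o1' -> opt_rel R o2 o2' ->
  U (fun n => o1 n = o2 n) -> U (fun n => o1' n = o2' n).
Proof.
move=> pR [h1|[a1 [b1 [r1 h1]]]] [h2|[a2 [b2 [r2 h2]]]] h.
- by apply: (U_mono2 fU) h1 h2 => n [_ ->] [_ ->].
- case: (U_False fU); apply: (U_mono3 fU) h1 h2 h => n [-> _] [-> _]; by [].
- case: (U_False fU); apply: (U_mono3 fU) h1 h2 h => n [-> _] [-> _]; by [].
- have : U (fun n => a1 n = a2 n).
    by apply: (U_mono3 fU) h1 h2 h => n [-> _] [-> _] [].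
  rewrite -sim_emb (R_simE pR r1 r2) sim_emb => h'.
  by apply: (U_mono3 fU) h1 h2 h' => n [_ ->] [_ ->] ->.
Qed.

Lemma lt_rel R o1 o1' o2 o2' : position star R -> opt_rel R o1 o1' -> opt_rel R o2 o2' ->
  U (fun n => lt_infty (o1 n) (o2 n)) -> U (fun n => lt_infty (o1' n) (o2' n)).
Proof.
move=> pR [h1|[a1 [b1 [r1 h1]]]] [h2|[a2 [b2 [r2 h2]]]] h.
- by case: (U_False fU); apply: (U_mono3 fU) h1 h2 h => n [-> _] [-> _].
- by case: (U_False fU); apply: (U_mono3 fU) h1 h2 h => n [-> _] [-> _].
- by apply: (U_mono2 fU) h1 h2 => n [_ ->] [_ ->].
- have : U (fun n => a1 n < a2 n).
    by apply: (U_mono3 fU) h1 h2 h => n [-> _] [-> _].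
  rewrite -pos_emb (R_pos pR (R_sub pR r2 r1)) pos_emb => h'.
  by apply: (U_mono3 fU) h1 h2 h' => n [_ ->] [_ ->].
Qed.

Lemma terms_rel R e e' t1 t2 : position star R -> env_rel R e e' ->
  exists R', [/\ position star R',
    opt_rel R' (fun n => eval D (e n) t1) (fun n => eval D (e' n) t1) &
    opt_rel R' (fun n => eval D (e n) t2) (fun n => eval D (e' n) t2)].
Proof.
move=> pR he; have [R1 [p1 s1 o1]] := term_rel t1 pR he.
have [R2 [p2 s2 o2]] := term_rel t2 p1 (env_rel_mono s1 he).
by exists R2; split=> //; apply: opt_rel_mono o1.
Qed.

(** An implication suffices, since the inverse position gives the converse; this is used for
    negations and premises. For a universal quantifier, a sequence of counterexamples on the second
    side is answered through the inverse position. *)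
Lemma formula_rel f : forall R e e', position star R -> env_rel R e e' ->
  U (fun n => sat D (e n) f) -> U (fun n => sat D (e' n) f).
Proof.
elim: f => [|t1 t2|t1 t2|f IH|f1 IH1 f2 IH2|f1 IH1 f2 IH2|f1 IH1 f2 IH2|f IH|f IH]
    R e e' pR he.
- by apply: (U_mono fU).
- have [R' [p1 o1 o2]] := terms_rel t1 t2 pR he; exact: eq_rel p1 o1 o2.
- have [R' [p1 o1 o2]] := terms_rel t1 t2 pR he; exact: lt_rel p1 o1 o2.
- rewrite /= !(U_not fU) => h h'; apply: h.
  exact: IH (position_inv pR) (env_rel_inv he) h'.
- by rewrite /= !(U_andE fU) => -[h1 h2]; split; [apply: IH1 he h1|apply: IH2 he h2].
- rewrite /= !(U_orE fU) => -[h|h]; [left; exact: IH1 he h|right; exact: IH2 he h].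
- rewrite /= !(U_impE fU) => h h1; apply: (IH2 _ _ _ pR he); apply: h.
  exact: IH1 (position_inv pR) (env_rel_inv he) h1.
- move=> /(U_ex fU _ None)[o h].
  have [R' [o' [pR' sub ho]]] := forth_opt o pR.
  have := IH _ _ _ pR' (env_rel_cons ho (env_rel_mono sub he)) h.
  by apply: (U_mono fU) => n h'; exists (o' n).
- move=> h; case: (U_dec fU (fun n => sat D (e' n) (FAll f))) => // h'.
  have : U (fun n => exists x, ~ sat D (env_cons x (e' n)) f).
    by apply: (U_mono fU) h' => n /existsNP.
  move=> /(U_ex fU _ None)[o' no].
  have [R' [o [pR' sub ho]]] := forth_opt o' (position_inv pR).
  have pR'' := position_inv pR'.
  have he' : env_rel (fun x y => R' y x) e e' by apply: env_rel_mono he => x y; apply: sub.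
  have h1 : U (fun n => sat D (env_cons (o n) (e n)) f).
    by apply: (U_mono fU) h => n; apply.
  have h2 := IH _ _ _ pR'' (env_rel_cons (opt_rel_inv ho) he') h1.
  case: (U_False fU); apply: (U_mono2 fU) no h2 => n; exact.
Qed.

End Formulas.

(** * Definable functions on Psi *)

Section IdentityPositions.
Variables (V : lmodType rat) (E : valued_data V) (ax : valued_laws E).
Local Notation W := (mark E).
Local Notation S := (nxt E).

(** When j is at infinite distance from c, one step from j crosses no iterate of c, and none of its
    iterates crosses c. *)
Lemma shift_type c j : W c -> W j -> (forall k, ~ sim E j (iter k S c)) ->
  (forall k, ~ sim E c (iter k S j)) -> forall k,
  (dom E j (iter k S c) <-> dom E (S j) (iter k S c)) /\
  (dom E c (iter k S j) <-> dom E c (iter k S (S j))).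
Proof.
move=> Wc Wj n1 n2 k; have iW := iter_mark ax.
have WSj := nxt_mark ax Wj.
split; last first.
  rewrite -iterSr /= (nxt_lt ax (iW k _ Wj) Wc); split=> h.
    by move=> h'; apply: (n2 k); apply: (mark_eq ax) => //; apply: iW.
  exact: (small_dom ax).
case: k => [|k] /=.
  split=> h; first exact: (dom_trans ax) (nxt_le ax Wj) h.
  apply: contrapT => h'; apply: (n2 1%N) => /=; apply: (mark_eq ax) => //.
  by split=> //; rewrite (nxt_lt ax Wj Wc).
rewrite (nxt_dom ax (iW k _ Wc) Wj) (nxt_lt ax (iW k _ Wc) Wj); split=> h.
  exact: (small_dom ax).
by move=> h'; apply: (n1 k); apply: (mark_eq ax) => //; apply: iW.
Qed.

Lemma same_typeE (R : V -> V -> Prop) j j' : position E R ->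
  (forall c c', R c c' -> W c -> sim E c c') -> W j -> W j' ->
  (forall c, R c c -> W c -> forall k,
    (dom E j (iter k S c) <-> dom E j' (iter k S c)) /\
    (dom E c (iter k S j) <-> dom E c (iter k S j'))) ->
  same_type E R j j'.
Proof.
move=> pR Rid Wj Wj' H c c' h Wc Wc' k; have cc := Rid _ _ h Wc.
have hc : R c c by apply: (R_sim pR h) (sim_refl ax _) (sim_sym cc).
have [h1 h2] := H _ hc Wc k.
rewrite h1 h2; split; apply: (dom_simE ax) => //; try exact: (sim_refl ax).
exact: (iter_sim ax).
Qed.

Variables (R : V -> V -> Prop) (pR : position E R).
Hypothesis Rid : forall x y, R x y -> sim E x y.
Hypothesis Rnxt : forall c, R c c -> W c -> R (S c) (S c).
Hypothesis Rpred : forall c d, R c c -> W c -> W d -> sim E c (S d) -> R d d.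

Lemma iter_diag k c : R c c -> W c -> R (iter k S c) (iter k S c).
Proof. by move=> h Wc; elim: k => //= k IH; apply: Rnxt => //; apply: (iter_mark ax). Qed.

Lemma pred_diag k c d : R c c -> W c -> W d -> sim E c (iter k S d) -> R d d.
Proof.
elim: k c => [|k IH] c h Wc Wd cd; first exact: (R_sim pR h cd cd).
have Wk := iter_mark ax k Wd.
exact: IH (Rpred h Wc Wk cd) Wk Wd (sim_refl ax _).
Qed.

Lemma same_type_refl j : W j -> same_type E R j j.
Proof. by move=> Wj; apply: same_typeE => // c c' /Rid. Qed.

(** Iterates of c stay in the domain. To compare c with the k-th iterate of j, pull c back k steps
    inside the domain and negate a comparison with the next mark; if c is fewer than k steps above
    [eps], it lies above no k-th iterate at all. *)
Lemma same_cut_type j j' : W j -> W j' ->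
  (forall c, R c c -> W c -> dom E j c <-> dom E j' c) -> same_type E R j j'.
Proof.
move=> Wj Wj' H; have iW := iter_mark ax; have We := eps_mark ax.
apply: same_typeE => // [c c' /Rid //|c h Wc k]; split; first by apply: H; [apply: iter_diag|apply: iW].
case: (pselect (dom E c (iter k S (eps E)))) => [/(iter_pred ax Wc)[d Wd cd]|no].
  have hd := pred_diag h Wc Wd cd; have hn := Rnxt hd Wd.
  have e i : W i -> dom E c (iter k S i) <-> ~ dom E i (S d).
    move=> Wi; rewrite (dom_simE ax cd (sim_refl ax _)) (iter_dom ax) //.
    exact: (ndom_nxt ax).
  by rewrite !e // H //; apply: (nxt_mark ax).
have e i : W i -> ~ dom E c (iter k S i).
  move=> Wi h'; apply: no; apply: (dom_trans ax) h' _; rewrite (iter_dom ax) //.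
  exact: (eps_max ax).
by split=> k1; [case: (e _ Wj k1)|case: (e _ Wj' k1)].
Qed.

End IdentityPositions.

Lemma bounded_choice (T : eqType) (t : seq T) (P : T -> nat -> Prop) :
  (forall x m n, (m <= n)%N -> P x m -> P x n) -> (forall x, exists n, P x n) ->
  exists n, forall x, x \in t -> P x n.
Proof.
move=> mono ex; elim: t => [|x t [n IH]]; first by exists 0%N.
have [m hm] := ex x; exists (maxn m n) => y.
by rewrite inE => /orP[/eqP ->|/IH h]; [apply: mono hm|apply: mono h]; rewrite ?leq_maxl ?leq_maxr.
Qed.

(** * Countable closure of the parameters and transfer of the graph of F *)

Section Definability.
Variables (G : porderZmodType) (D : log_structure G) (hD : models_Tlog D).
Variable e0 : nat -> option G.

Local Notation psi := (lpsi D).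
Local Notation s := (ls D).
Local Notation Psi := (Psi psi).
Local Notation H := (hat_data hD).
Local Notation HM := (hat_mark hD).
Local Notation V := (nat -> hat hD).

Lemma value_fun : exists v : hat hD -> hat hD,
  forall x, x != 0 -> mark H (v x) /\ eqval H x (v x).
Proof.
suff /choice[v hv] : forall x : hat hD, exists y, x != 0 -> mark H y /\ eqval H x y.
  by exists v.
move=> x; have [->|x0] := eqVneq x 0; first by exists 0.
have nz : ~ null H x by rewrite hat_null; apply/eqP.
by have [c h1 h2] := mark_val (hat_laws hD) nz; exists c.
Qed.

Lemma pred_fun : exists v : hat hD -> hat hD,
  forall d, mark H d -> v (nxt H d) = d.
Proof.
suff /choice[v hv] : forall x : hat hD, exists y, forall d, mark H d -> x = nxt H d -> y = d.
  by exists v => d hd; apply: hv.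
move=> x; case: (pselect (exists2 d, mark H d & x = nxt H d)) => [[d hd e]|no]; last first.
  by exists 0 => d hd e; case: no; exists d.
exists d => d' hd' e'; apply/(hat_sim (hD := hD)); apply: (mark_eq (hat_laws hD)) => //.
have e2 : nxt H d = nxt H d' by rewrite -e -e'.
have ax := hat_laws hD.
split; rewrite -(nxt_dom ax) // e2; exact: (dom_refl ax).
Qed.

Section Closure.
Variables (v w : hat hD -> hat hD).
Hypothesis hv : forall x, x != 0 -> mark H (v x) /\ eqval H x (v x).
Hypothesis hw : forall d, mark H d -> w (nxt H d) = d.

(* [v] and [w] choose the mark with the same value and the predecessor of a mark.
   The union of the stages is the countable closure of the parameters. *)
Fixpoint stage (n : nat) : seq (hat hD) :=
  if n is m.+1 then
    let L := stage m in
    L ++ emb0 hD (odflt 0 (e0 m)) ::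
    (* Only rationals of code below m are used: each stage is finite and every rational eventually
       appears. *)
    [seq x.1 *: x.2 + y | x <- [seq (q, x) | q <- pmap unpickle (iota 0 m), x <- L], y <- L] ++
    map v L ++ map (nxt H) L ++ map w L
  else [:: eps H].

Definition closed_set (x : hat hD) := exists n, x \in stage n.

Lemma stage_mono m n x : (m <= n)%N -> x \in stage m -> x \in stage n.
Proof.
move=> mn; rewrite -(subnK mn); elim: (n - m)%N => // k IH /IH h.
by rewrite addSn /= mem_cat h.
Qed.

Lemma closed_eps : closed_set (eps H).
Proof. by exists 0%N; rewrite inE. Qed.

Lemma closed_param k g : e0 k = Some g -> closed_set (emb0 hD g).
Proof. by move=> e; exists k.+1; rewrite /= mem_cat inE e /= eqxx orbT. Qed.

Lemma closed_v x : closed_set x -> closed_set (v x).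
Proof.
by case=> n h; exists n.+1; rewrite /= mem_cat inE !mem_cat (map_f v h) !orbT.
Qed.

Lemma closed_nxt x : closed_set x -> closed_set (nxt H x).
Proof.
by case=> n h; exists n.+1; rewrite /= mem_cat inE !mem_cat (map_f (nxt H) h) !orbT.
Qed.

Lemma closed_w x : closed_set x -> closed_set (w x).
Proof.
by case=> n h; exists n.+1; rewrite /= mem_cat inE !mem_cat (map_f w h) !orbT.
Qed.

Lemma closed_lin q x y : closed_set x -> closed_set y -> closed_set (q *: x + y).
Proof.
move=> [m hx] [n hy]; pose k := maxn (pickle q).+1 (maxn m n).
have hx' : x \in stage k by apply: stage_mono hx; rewrite !leq_max leqnn !orbT.
have hy' : y \in stage k by apply: stage_mono hy; rewrite !leq_max leqnn !orbT.
exists k.+1; rewrite /= mem_cat inE !mem_cat.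
rewrite (_ : q *: x + y \in [seq _ | _ <- _, _ <- _]) ?orbT //.
apply/allpairsP; exists ((q, x), y) => /=; split=> //.
apply/allpairsP; exists (q, x); split=> //=.
rewrite mem_pmap; apply/mapP; exists (pickle q); last by rewrite pickleK.
by rewrite mem_iota leq0n add0n leq_max leqnn.
Qed.

Definition breaks (n : nat) : seq G :=
  [seq g <- [seq - (x.1 : G) | x <- stage n] | `[< Psi g >] && (HM g \in stage n)].

Lemma breaks_Psi n g : g \in breaks n -> Psi g /\ closed_set (HM g).
Proof.
by rewrite mem_filter => /andP[/andP[/asboolP h1 h2] _]; split=> //; exists n.
Qed.

Lemma breaks_mono m n g : (m <= n)%N -> g \in breaks m -> g \in breaks n.
Proof.
move=> mn; rewrite !mem_filter => /andP[/andP[-> h] /mapP[x hx e]] /=.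
rewrite (stage_mono mn h) /= e; apply/mapP; exists x => //; exact: stage_mono hx.
Qed.

Lemma mem_breaks g : Psi g -> closed_set (HM g) -> exists n, g \in breaks n.
Proof.
move=> h1 [n h2]; exists n; rewrite mem_filter h2; apply/andP; split.
  by apply/andP; split=> //; apply/asboolP.
by apply/mapP; exists (HM g); rewrite //= opprK.
Qed.


Variables (U : (nat -> Prop) -> Prop) (fU : free_ultrafilter U).
Local Notation star := (star hD U).
Local Notation slaws := (star_laws hD fU).
Definition cst (x : hat hD) : V := fun=> x.

(** The identity of the closure, embedded diagonally; every game below starts from it. *)
Definition const_rel (x y : V) : Prop :=
  exists2 u, closed_set u & sim star x (cst u) /\ sim star y (cst u).

Lemma const_rel_id x y : const_rel x y -> sim star x y.
Proof. by move=> [u _ [h1 h2]]; apply: (sim_trans slaws) h1 (sim_sym h2). Qed.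

Lemma const_rel_cst u : closed_set u -> const_rel (cst u) (cst u).
Proof. by exists u => //; split; apply: (sim_refl slaws). Qed.

Lemma const_position : position star const_rel.
Proof.
split.
- exact: const_rel_cst closed_eps.
- move=> q x y x' y' [u hu [h1 h2]] [u' hu' [h1' h2']].
  exists (q *: u + u'); first exact: closed_lin.
  by split; [apply: (sim_lin slaws q h1 h1')|apply: (sim_lin slaws q h2 h2')].
- move=> x y x' y' [u hu [h1 h2]] xx yy; exists u => //.
  by split; [apply: (sim_trans slaws) (sim_sym xx) h1|apply: (sim_trans slaws) (sim_sym yy) h2].
- by move=> x y /const_rel_id; apply: (pos_simE slaws).
- by move=> x y /const_rel_id; apply: (gam_simE slaws).
- move=> x y [u hu [h1 h2]] nz.
  have u0 : u != 0.
    apply/negP => /eqP e; apply: nz; rewrite (null_simE slaws h1) e; exact: (null0 slaws).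
  have [m1 m2] := hv u0.
  have a : eqval star (cst u) (cst (v u)) by rewrite (ultra_eqval fU); apply: (U_all fU).
  exists (cst (v u)), (cst (v u)); split.
  + by apply: const_rel_cst; apply: closed_v.
  + exact: (U_all fU).
  + exact: (U_all fU).
  + exact: (eqval_trans slaws) (sim_eqval slaws h1) a.
  + exact: (eqval_trans slaws) (sim_eqval slaws h2) a.
- move=> c c' d d' /const_rel_id h1 /const_rel_id h2 Wc Wc' Wd Wd' k.
  by apply: (dom_simE slaws) => //; apply: (iter_sim slaws).
- apply: (@cnt_of _ star (nat * nat)%type (0, 0)%N _
    (fun t => (cst (nth (eps H) (stage t.1) t.2), cst (nth (eps H) (stage t.1) t.2)))).
    move=> [m n] /=; apply: const_rel_cst.
    case: (ltnP n (size (stage m))) => h; first by exists m; apply: mem_nth.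
    by rewrite nth_default //; apply: closed_eps.
  move=> x y [u [n hn] [h1 h2]]; exists (n, index u (stage n)) => /=.
  by rewrite nth_index.
Qed.

Lemma const_nxt c : const_rel c c -> mark star c -> const_rel (nxt star c) (nxt star c).
Proof.
move=> [u hu [cu _]] Wc; exists (nxt H u); first exact: closed_nxt.
have Wu : mark star (cst u) := mark_sim slaws Wc cu.
by split; apply: (nxt_sim slaws Wc Wu cu).
Qed.

Lemma const_pred c d : const_rel c c -> mark star c -> mark star d ->
  sim star c (nxt star d) -> const_rel d d.
Proof.
move=> [u hu [cu _]] Wc Wd cd; exists (w u); first exact: closed_w.
suff h : sim star d (cst (w u)) by [].
have := sim_trans slaws (sim_sym cu) cd; rewrite !(star_sim fU) => h.
by apply: (U_mono2 fU) h Wd => n e md; rewrite /cst -[u]/(cst u n) e hw.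
Qed.

Definition marks (x : nat -> G) : V := fun n => HM (x n).

Lemma marks_mark x : (forall n, Psi (x n)) -> mark star (marks x).
Proof. by move=> h; apply: (U_all fU) => n; exists (x n) => //; right. Qed.

(** If y were almost everywhere one fixed breakpoint of some stage N, then [breaks n] would contain
    y n for almost every n, since these lists increase. *)
Lemma not_const_marks y : (forall n, Psi (y n)) -> (forall n, y n \notin breaks n) ->
  ~ const_rel (marks y) (marks y).
Proof.
move=> hy nb [u hu [h _]]; rewrite (star_sim fU) in h.
have [n0 e] : exists n, HM (y n) = u.
  by apply: contrapT => no; apply: (U_False fU); apply: (U_mono fU) h => n h; apply: no; exists n.
rewrite -e in hu; have [N hN] := mem_breaks (hy n0) hu.
apply: (U_False fU); apply: (U_mono2 fU) h (U_tail fU N) => n k Nn.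
have k' : y n = y n0 by apply: (@hat_mark_inj _ _ hD); rewrite e; exact: k.
by have := nb n; rewrite k' (breaks_mono Nn hN).
Qed.

Variables (F : G -> G) (f : Lformula).
Hypothesis F_Psi : maps_Psi psi F.
Hypothesis F_graph : forall x y : option G,
  (exists2 a : G, Psi a & x = Some a /\ y = Some (F a)) <->
  sat D (env_cons x (env_cons y e0)) f.

Lemma marks_opt_rel R x y : position star R -> R (marks x) (marks y) ->
  (forall n, Psi (x n)) -> mark star (marks y) ->
  opt_rel U R (fun n => Some (x n)) (fun n => Some (y n)).
Proof.
move=> pR h hx hy; right; exists x, y; split; last exact: (U_all fU).
have := emb_mark_gam fU pR h (marks_mark hx) hy.
rewrite /marks (_ : (fun n => (eps star n - HM (x n)).1) = x); last first.
  by apply/funext => n; apply: fst_eps_mark.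
by rewrite (_ : (fun n => (eps star n - HM (y n)).1) = y) //; apply/funext => n; apply: fst_eps_mark.
Qed.

(** The formula defining the graph has its parameters in the closure, which R fixes. *)
Lemma graph_transfer R x x' y' : position star R ->
  (forall a b, const_rel a b -> R a b) ->
  (forall n, Psi (x n)) -> R (marks x) (marks x') -> R (marks (F \o x)) (marks y') ->
  U (fun n => Psi (x' n) /\ y' n = F (x' n)).
Proof.
move=> pR sub hx h1 h2.
have hF n : Psi ((F \o x) n) by apply: F_Psi.
have W1 := R_mark slaws pR h1 (marks_mark hx); have W2 := R_mark slaws pR h2 (marks_mark hF).
have o1 := marks_opt_rel pR h1 hx W1; have o2 := marks_opt_rel pR h2 hF W2.
have o3 : env_rel U R (fun=> e0) (fun=> e0).
  move=> k; case e : (e0 k) => [g|].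
    right; exists (fun=> g), (fun=> g); split; last exact: (U_all fU).
    by apply: sub; apply: const_rel_cst; apply: closed_param e.
  by left; apply: (U_all fU).
have := formula_rel fU pR (env_rel_cons o1 (env_rel_cons o2 o3)).
move=> /(_ f) k.
have : U (fun n => sat D (env_cons (Some (x n)) (env_cons (Some (F (x n))) e0)) f).
  by apply: (U_all fU) => n; rewrite -F_graph; exists (x n).
move=> /k; apply: (U_mono fU) => n; rewrite -F_graph => -[a ha [[->] [->]]].
by split.
Qed.

Lemma iter_marks k x : iter k (nxt star) (marks x) = marks (fun n => iter k s (x n)).
Proof.
apply/funext => n; rewrite ultra_iter /marks; elim: k => //= k ->.
exact: hat_nxt.
Qed.

Lemma sim_marks x y : sim star (marks x) (marks y) <-> U (fun n => x n = y n).
Proof.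
by rewrite (star_sim fU); split; apply: (U_mono fU) => n; [move=> /hat_mark_inj|rewrite /marks => ->].
Qed.

(* Otherwise, along the ultrafilter, F x has the same type as s(F x) over x and the
   parameters. *)
Lemma finitely_many_values : exists N, forall x, Psi x ->
  F x \in breaks N \/ exists2 l, (l <= N)%N & F x = iter l s x \/ x = iter l s (F x).
Proof.
apply: contrapT => /forallNP no.
have /choice[x hx] : forall N, exists x, [/\ Psi x, F x \notin breaks N &
    forall l, (l <= N)%N -> F x <> iter l s x /\ x <> iter l s (F x)].
  move=> N; have := no N => /existsNP[x /not_implyP[px h]]; exists x; split=> //.
    by apply/negP => h'; apply: h; left.
  by move=> l lN; split=> e; apply: h; right; exists l => //; [left|right].
have px n : Psi (x n) by case: (hx n).
have py n : Psi ((F \o x) n) by apply: F_Psi.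
have WX := marks_mark px; have WY := marks_mark py.
have st := same_type_refl slaws const_position const_rel_id WX.
have [R1 [p1 sub1 RX ch]] := add_mark slaws const_position WX WX st.
have nY : ~ const_rel (marks (F \o x)) (marks (F \o x)).
  by apply: not_const_marks => // n; case: (hx n).
set Y := marks (F \o x) in nY WY; have WSY := nxt_mark slaws WY.
have R1id c c' : R1 c c' -> mark star c -> sim star c c'.
  move=> h Wc; case: (ch _ _ h Wc) => [[d [d' [/const_rel_id dd _ cd cd']]]|[h1 h2]].
    exact: (sim_trans slaws) cd (sim_trans slaws dd (sim_sym cd')).
  exact: (sim_trans slaws) h1 (sim_sym h2).
(* Every mark in the domain of R1 is a constant of the closure or X. By the choice of x, Y is at
   infinite distance from X, and also from the constants because the closure is stable under
   successors and predecessors. *)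
have st2 : same_type star R1 Y (nxt star Y).
  apply: (same_typeE slaws p1 R1id) => // c h Wc k; apply: (shift_type slaws) => // m h'.
    case: (ch _ _ h Wc) => [[d [d' [dd Wd cd _]]]|[cX _]].
      have {}dd : const_rel d d.
        by apply: (R_sim const_position dd (sim_refl slaws _)); apply/sim_sym/const_rel_id.
      have yd := sim_sym (sim_trans slaws h' (iter_sim slaws m Wc Wd cd)).
      by apply: nY; apply: (R_sim const_position (iter_diag slaws const_nxt m dd Wd) yd yd).
    have := sim_trans slaws h' (iter_sim slaws m Wc WX cX); rewrite iter_marks sim_marks => e.
    apply: (U_False fU); apply: (U_mono2 fU) e (U_tail fU m) => n e mn.
    by have [_ _ /(_ m mn)[]] := hx n.
  case: (ch _ _ h Wc) => [[d [d' [dd Wd cd _]]]|[cX _]].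
    have {}dd : const_rel d d.
      by apply: (R_sim const_position dd (sim_refl slaws _)); apply/sim_sym/const_rel_id.
    exact: nY (pred_diag slaws const_position const_pred dd Wd WY (sim_trans slaws (sim_sym cd) h')).
  have := sim_trans slaws (sim_sym cX) h'; rewrite iter_marks sim_marks => e.
  apply: (U_False fU); apply: (U_mono2 fU) e (U_tail fU m) => n e mn.
  by have [_ _ /(_ m mn)[]] := hx n.
have [R2 [p2 sub2 RY _]] := add_mark slaws p1 WY WSY st2.
have eS : nxt star Y = marks (fun n => s (F (x n))) := iter_marks 1 _.
rewrite eS in RY.
have := graph_transfer p2 (fun a b h => sub2 _ _ (sub1 _ _ h)) px (sub2 _ _ RX) RY.
move=> h; apply: (U_False fU); apply: (U_mono fU) h => n [_ e].
have [_ lt _] := Psi0_s hD (or_intror (F_Psi (px n))).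
by rewrite e ltxx in lt.
Qed.

(** The last case means that y is the l-th iterate of p at x; writing it with s avoids infinity. *)
Definition option_rel (o : G + bool * nat) (x y : G) : Prop :=
  match o with
  | inl g => y = g
  | inr (true, l) => y = iter l s x
  | inr (false, l) => x = iter l s y
  end.

Definition same_cut (N : nat) (x x' : G) := forall b, b \in breaks N -> (b <= x) = (b <= x').

(** Counterexamples for every N give sequences x and x' with the same cut in the whole closure,
    hence related by a position. Its answer y' to F x is F x' by transfer of the graph, while y'
    bears the relation o to x' because types are preserved. *)
Lemma option_invariant o : (forall g, o = inl g -> Psi g /\ closed_set (HM g)) ->
  exists N, forall x x', Psi x -> Psi x' -> same_cut N x x' ->
    option_rel o x (F x) -> option_rel o x' (F x').
Proof.
move=> ho; apply: contrapT => /forallNP no.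
have /choice[xx hx] : forall N, exists xx : G * G, [/\ Psi xx.1, Psi xx.2,
    same_cut N xx.1 xx.2, option_rel o xx.1 (F xx.1) & ~ option_rel o xx.2 (F xx.2)].
  move=> N; have := no N => /existsNP[x /existsNP[x' h]]; exists (x, x').
  by move: h => /not_implyP[h1 /not_implyP[h2 /not_implyP[h3 /not_implyP[h4 h5]]]].
pose x n := (xx n).1; pose x' n := (xx n).2.
have px n : Psi (x n) by case: (hx n).
have px' n : Psi (x' n) by case: (hx n).
have py n : Psi ((F \o x) n) by apply: F_Psi.
have WX := marks_mark px; have WX' := marks_mark px'; have WY := marks_mark py.
have st : same_type star const_rel (marks x) (marks x').
  apply: (same_cut_type slaws const_position const_rel_id const_nxt const_pred) => //.
  move=> c [u hu [cu _]] Wc.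
  have /(U_const fU)[g hg ug] : U (fun=> mark H u) := mark_sim slaws Wc cu.
  rewrite (dom_simE slaws (sim_refl slaws _) cu) (dom_simE slaws (sim_refl slaws _) cu).
  have p0 n : Psi0 D (x n) by right.
  have p0' n : Psi0 D (x' n) by right.
  have e1 : dom star (marks x) (cst u) <-> U (fun n => g <= x n).
    by apply: (U_iff fU); apply: (U_all fU) => n; rewrite /cst ug; apply: hat_mark_dom.
  have e2 : dom star (marks x') (cst u) <-> U (fun n => g <= x' n).
    by apply: (U_iff fU); apply: (U_all fU) => n; rewrite /cst ug; apply: hat_mark_dom.
  rewrite e1 e2; apply: (U_iff fU); case: hg => [->|hg].
    apply: (U_all fU) => n.
    by split=> _; apply: (Psi0_ge0 hD).
  rewrite ug in hu; have [N hN] := mem_breaks hg hu.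
  apply: (U_mono fU) (U_tail fU N) => n Nn.
  by have [_ _ /(_ _ (breaks_mono Nn hN)) -> _ _] := hx n.
have [R1 [p1 sub1 RX _]] := add_mark slaws const_position WX WX' st.
have [R2 [Y' [p2 sub2 RY WY']]] := extend_mark slaws (star_sat hD fU) p1 WY.
have [y' hy'] : exists y', U (fun n => Y' n = HM (y' n)).
  apply/(U_ex fU (fun n g => Y' n = HM g) 0); apply: (U_mono fU) WY' => n [g _ ->].
  by exists g.
have {}RY : R2 (marks (F \o x)) (marks y').
  by apply: (R_sim p2 RY (sim_refl slaws _)); rewrite (star_sim fU).
have res := graph_transfer p2 (fun a b h => sub2 _ _ (sub1 _ _ h)) px (sub2 _ _ RX) RY.
have iter_sync k a b c d : R2 (marks a) (marks b) -> R2 (marks c) (marks d) ->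
    (forall n, Psi (a n)) -> (forall n, Psi (c n)) ->
    U (fun n => a n = iter k s (c n)) -> U (fun n => b n = iter k s (d n)).
  move=> ab cd pa pc; rewrite -!sim_marks -!iter_marks.
  have Wa := marks_mark pa; have Wc := marks_mark pc.
  have Wb := R_mark slaws p2 ab Wa; have Wd := R_mark slaws p2 cd Wc.
  move=> /(sim_eqval slaws)[h1 h2]; apply: (mark_eq slaws) => //; first exact: (iter_mark slaws).
  split; first exact/(R_typ2 slaws 0 k p2 cd ab Wc Wa).
  exact/(R_typ2 slaws k 0 p2 ab cd Wa Wc).
suff h : U (fun n => option_rel o (x' n) (y' n)).
  apply: (U_False fU); apply: (U_mono2 fU) h res => n h [_ e].
  by have [_ _ _ _] := hx n; rewrite -/(x' n) -e.
have hox : U (fun n => option_rel o (x n) ((F \o x) n)).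
  by apply: (U_all fU) => n; case: (hx n).
case: o ho hox {no hx} => [g|[[] l]] ho hox /=.
- have [pg cg] := ho g erefl.
  apply: (iter_sync 0%N (F \o x) y' (fun=> g) (fun=> g)) => //.
  exact: sub2 (sub1 _ _ (const_rel_cst cg)).
- exact: (iter_sync l _ _ x x' RY (sub2 _ _ RX)).
- exact: (iter_sync l x x' _ _ (sub2 _ _ RX) RY).
Qed.

(** Only finitely many descriptions o occur, so a single stage controls the invariance of all of
    them. *)
Lemma piecewise : exists B : seq G, (forall b, b \in B -> Psi b) /\
  forall y, Psi y -> exists o, forall x, Psi x ->
    (forall b, b \in B -> (b <= y) = (b <= x)) -> option_rel o x (F x).
Proof.
have [N0 hN0] := finitely_many_values.
pose O : seq (G + bool * nat) := map inl (breaks N0) ++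
  [seq inr (b, l) | b <- [:: true; false], l <- iota 0 N0.+1].
pose P o n := o \in O -> forall x x', Psi x -> Psi x' -> same_cut n x x' ->
  option_rel o x (F x) -> option_rel o x' (F x').
have [||N hN] := @bounded_choice _ O P.
- move=> o m n mn h oO x x' px px' cut; apply: h => // b bm.
  by apply: cut; apply: breaks_mono bm.
- move=> o; case: (pselect (o \in O)) => oO; last by exists 0%N.
  have [|n hn] := @option_invariant o; last by exists n => _.
  move=> g e; apply: (@breaks_Psi N0).
  move: oO; rewrite e /O mem_cat => /orP[/mapP[g' h [->]] //|].
  by move=> /allpairsP[[b l] [_ _]].
exists (breaks N); split=> [b /breaks_Psi[] //|y py].
have mem_O b l : (l <= N0)%N -> inr (b, l) \in O.
  move=> lN; rewrite mem_cat; apply/orP; right; apply/allpairsP; exists (b, l).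
  by split=> //; [case: b|rewrite mem_iota].
have [o oO oy] : exists2 o, o \in O & option_rel o y (F y).
  case: (hN0 y py) => [h|[l lN [e|e]]].
  - by exists (inl (F y)) => //; rewrite mem_cat map_f.
  - by exists (inr (true, l)); first exact: mem_O.
  - by exists (inr (false, l)); first exact: mem_O.
by exists o => x px cut; apply: (hN o oO oO y).
Qed.

End Closure.

End Definability.

(** * Cutting Psi at finitely many breakpoints *)

Section Partition.
Variables (G : porderZmodType) (D : log_structure G) (hD : models_Tlog D).
Local Notation Psi := (Psi (lpsi D)).
Local Notation s := (ls D).
Local Notation in_interval := (in_Psi_interval (lpsi D)).

Let hG := ac_group (T0_couple (Tlog_T0 hD)).

Lemma iter_lp l x y : Psi x -> y = iter l s x -> iter l (lp D) (Some y) = Some x.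
Proof.
move=> px ->; elim: l => // l IH; rewrite iterSr /= (lp_succ hD) //.
by elim: l {IH} => //= l IH; apply: (Psi_s hD); right.
Qed.

Lemma option_rel_spow o (I : G -> Prop) (F : G -> G) :
  (forall x, I x -> Psi (F x) /\ option_rel D o x (F x)) ->
  (exists c, forall x, I x -> F x = c) \/
  (exists l : int, forall x, I x -> Some (F x) = spow D l (Some x)).
Proof.
case: o => [g|[[] l]] h.
- by left; exists g => x /h[].
- right; exists (Posz l) => x /h[_ /= ->].
  by elim: l {h} => //= l <-.
(* [Negz l] iterates p l + 1 times, so l = 0 is the identity and belongs to [Posz 0]. *)
- right; case: l h => [|l] h; first by exists (Posz 0) => x /h[_ /= e]; rewrite -e.
  by exists (Negz l) => x /h[pF /(iter_lp pF (l := l.+1)) <-].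
Qed.

(** The sample point y is the left endpoint: no element of B lies above it and at or below another
    point of the interval. *)
Lemma sorted_breaks (B : seq G) : (forall b, b \in B -> Psi b) ->
  exists (n : nat) (alpha : nat -> option G),
    [/\ alpha 0%N = Some (s 0), alpha n = None,
      (forall k, (k <= n)%N -> Psi_infty (lpsi D) (alpha k)),
      (forall k, (k < n)%N -> lt_infty (alpha k) (alpha k.+1)) &
      forall k, (1 <= k <= n)%N -> exists2 y, Psi y &
        forall x, in_interval (alpha k.-1) (alpha k) x ->
          forall b, b \in B -> (b <= y) = (b <= x)].
Proof.
move=> hB; have [ps0 least] := T0_least (Tlog_T0 hD).
(* Adding [s 0] makes the first interval start at the least element of Psi; removing duplicates
   makes the sequence strictly increasing. *)
pose C := sort <=%O (undup (s 0 :: B)).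
have memC b : (b \in C) = (b \in s 0 :: B) by rewrite mem_sort mem_undup.
have hC b : b \in C -> Psi b by rewrite memC inE => /orP[/eqP ->|/hB].
have srt : sorted <=%O C by apply: sort_sorted; exact: (oag_total hG).
have slt : sorted <%O C by rewrite lt_sorted_uniq_le sort_uniq undup_uniq.
have s0C : s 0 \in C by rewrite memC mem_head.
pose nt k := nth 0 C k.
have mono i j : (i <= j)%N -> (j < size C)%N -> nt i <= nt j.
  move=> ij jC; apply: (sorted_leq_nth (@le_trans _ _) (@lexx _ _)) => //.
  exact: leq_ltn_trans ij jC.
have size0 : (0 < size C)%N by case: C s0C {memC hC srt slt nt mono}.
pose alpha k := if (k < size C)%N then Some (nt k) else None.
exists (size C), alpha; split.
- rewrite /alpha size0; congr Some; apply/eqP; rewrite eq_le least; last first.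
    by apply: hC; apply: mem_nth.
  by rewrite andbT -(nth_index 0 s0C) mono // index_mem.
- by rewrite /alpha ltnn.
- by move=> k _; rewrite /alpha; case: ifP => //= h; apply: hC; apply: mem_nth.
- move=> k kC; rewrite /alpha kC; case: ifP => //= h.
  exact: (sorted_ltn_nth (@lt_trans _ _)).
- case=> // k /= kC; exists (nt k); first by apply: hC; apply: mem_nth.
  rewrite /alpha kC => x [px h1 h2] b bB.
  have {}h1 : nt k <= x.
    by case/orP: h1 => [/eqP[->] //|/ltW].
  have bC : b \in C by rewrite memC inE bB orbT.
  apply/idP/idP => h; first exact: le_trans h h1.
  rewrite -(nth_index 0 bC) -/(nt _) mono //.
  rewrite leqNgt; apply/negP => ki.
  have iC : (index b C < size C)%N by rewrite index_mem.
  move: h2; rewrite (leq_ltn_trans ki iC) /= => xk.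
  have := mono _ _ ki iC; rewrite /nt nth_index // => kb.
  by have := lt_le_trans xk (le_trans kb h); rewrite ltxx.
Qed.

End Partition.

Theorem corollary6p12 (G : porderZmodType) (D : log_structure G)
    (hD : models_Tlog D) (F : G -> G)
    (F_Psi : maps_Psi (lpsi D) F)
    (F_def : definable_on_Psi D F) :
  exists (n : nat) (alpha : nat -> option G),
    alpha 0%N = Some (ls D 0) /\
    alpha n = None /\
    (forall k : nat, (k <= n)%N -> Psi_infty (lpsi D) (alpha k)) /\
    (forall k : nat, (k < n)%N -> lt_infty (alpha k) (alpha k.+1)) /\
    (forall k : nat, (1 <= k <= n)%N ->
       (exists c : G, forall x : G,
          in_Psi_interval (lpsi D) (alpha k.-1) (alpha k) x -> F x = c) \/
       (exists l : int, forall x : G,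
          in_Psi_interval (lpsi D) (alpha k.-1) (alpha k) x ->
          Some (F x) = spow D l (Some x))).
Proof.
have [f [e0 graph]] := F_def.
have [v hv] := value_fun hD; have [w hw] := pred_fun hD.
have [U fU] := exists_free_ultrafilter.
have [B [hB pw]] := piecewise (e0 := e0) hv hw fU F_Psi graph.
have [n [alpha [a0 an aP alt cut]]] := sorted_breaks hD hB.
exists n, alpha; do 4 (split=> //); move=> k /cut[y py cy].
have [o ho] := pw y py.
apply: (option_rel_spow hD (o := o)) => x hx; have [px _ _] := hx.
by split; [apply: F_Psi|apply: ho => //; apply: cy].
Qed.
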